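(* Let $R$ be a commutative Noetherian integral domain such that the category $D^b(R\text{-mod})$ is regular. Let $d$ be the Rouquier dimension of $D^b(R\text{-mod})$. Then there exists a non-zero element $f\in R$ such that $\operatorname{Ext}^k_R(M,N)$ is annihilated by $f$ for any finitely generated $R$-modules $M$ and $N$ and any $k>d$. In particular, $ca_{d+1}(R)\ne 0$.
   Context: $D^b(R\text{-mod})$ is the bounded derived category of finitely generated $R$-modules. For $k\ge 0$ the ideal $ca_k(R)\subset R$ is $ca_k(R)=\bigcap_{M,N}\operatorname{ann}\operatorname{Ext}^k_R(M,N)$, the intersection being over all finitely generated $R$-modules $M,N$. For an object $G$ of a triangulated category $\mathcal T$: $[G]_0$ is the full subcategory of (objects isomorphic to) finite direct sums of shifts of $G$; for $k\ge 1$, $[G]_k$ is the full subcategory of objects $F$ for which there is a distinguished triangle $F_{k-1}\to F\to F_0\to F_{k-1}[1]$ with $F_0\in[G]_0$ and $F_{k-1}\in[G]_{k-1}$; and $\langle G\rangle_n$ is the full subcategory of direct summands in $\mathcal T$ of objects of $[G]_n$. $\mathcal T$ is regular if there are $G\in\mathcal T$ and $n$ with $\mathcal T=\langle G\rangle_n$; its Rouquier dimension is the minimal integer $n$ such that $\mathcal T=\langle G\rangle_n$ for some $G\in\mathcal T$. *)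

(* Defs.v *)
From HB Require Import structures.
From mathcomp Require Import all_boot all_order all_algebra.
From mathcomp Require Import boolp classical_sets.

Set Implicit Arguments.
Unset Strict Implicit.
Unset Printing Implicit Defensive.

Import Order.TTheory GRing.Theory Num.Theory.
Local Open Scope ring_scope.
Local Open Scope classical_set_scope.

Definition is_ideal (R : comNzRingType) (I : set R) : Prop :=
  [/\ I 0, forall x y, I x -> I y -> I (x + y) & forall a x, I x -> I (a * x)].

Definition noetherian (R : comNzRingType) : Prop :=
  forall I : set R, is_ideal I ->
    exists s : seq R,
      I = [set x | exists c : 'I_(size s) -> R, x = \sum_i c i * s`_i].

Definition fgmod (R : comNzRingType) (M : lmodType R) : Prop :=
  exists s : seq M,
    forall x : M, exists c : 'I_(size s) -> R, x = \sum_i c i *: s`_i.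

Definition projective (R : comNzRingType) (P : lmodType R) : Prop :=
  forall (A B : lmodType R) (g : {linear A -> B}) (h : {linear P -> B}),
    (forall b : B, exists a : A, g a = b) ->
    exists h' : {linear P -> A}, forall x : P, g (h' x) = h x.

Record projres (R : comNzRingType) (M : lmodType R) := ProjRes {
  pr_obj : nat -> lmodType R;
  pr_d : forall n, {linear pr_obj n.+1 -> pr_obj n};
  pr_aug : {linear pr_obj 0%N -> M};
  pr_proj : forall n, projective (pr_obj n);
  pr_aug_surj : forall y, exists x, pr_aug x = y;
  pr_exact0 : forall x, pr_aug x = 0 <-> exists z, pr_d 0%N z = x;
  pr_exactS : forall n x, pr_d n x = 0 <-> exists z, pr_d n.+1 z = x
}.

Section Ext.
Variables (R : comNzRingType) (M N : lmodType R) (P : projres M).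

(* Cocycles and coboundaries of the complex Hom(P, N), whose degree k
   cohomology is Ext^k(M, N). *)
Definition ext_cocycle k (phi : {linear pr_obj P k -> N}) : Prop :=
  forall z, phi (pr_d P k z) = 0.

Definition ext_coboundary k : ({linear pr_obj P k -> N}) -> Prop :=
  match k with
  | 0%N => fun phi => forall x, phi x = 0
  | j.+1 => fun phi =>
      exists psi : {linear pr_obj P j -> N},
        forall x, phi x = psi (pr_d P j x)
  end.

End Ext.

(* The annihilator of Ext^k(M, N): multiplication by r on a class is induced
   by r \*: phi. Different projective resolutions of M give isomorphic Ext
   modules, hence the same annihilator. *)
Definition annExt (R : comNzRingType) (k : nat) (M N : lmodType R) : set R :=
  [set r | forall (P : projres M) (phi : {linear pr_obj P k -> N}),
     ext_cocycle phi -> ext_coboundary (r \*: phi : {linear pr_obj P k -> N})].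

Definition ca (R : comNzRingType) (k : nat) : set R :=
  [set r | forall M N : lmodType R, fgmod M -> fgmod N -> annExt k M N r].
Arguments ca R k : clear implicits.

(* Cohomological complexes. The differential is given for all pairs of
   degrees, and vanishes unless the target degree is the successor of the
   source degree; shifts then need no transport along equalities in int. *)
Record complex (R : comNzRingType) := Complex {
  cobj :> int -> lmodType R;
  cd : forall i j, {linear cobj i -> cobj j};
  cd_shape : forall i j, j != i + 1 -> forall x, cd i j x = 0;
  cd_cd : forall i j k x, cd j k (cd i j x) = 0
}.

Definition cbounded (R : comNzRingType) (X : complex R) : Prop :=
  exists b : int, forall i, b < `|i| -> forall x : X i, x = 0.

Definition cfg (R : comNzRingType) (X : complex R) : Prop :=
  forall i, fgmod (X i).

(* Bounded complexes of finitely generated modules: the objects of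
   D^b(R-mod). *)
Record bcomplex (R : comNzRingType) := BComplex {
  bcx :> complex R;
  bcx_bounded : cbounded bcx;
  bcx_fg : cfg bcx
}.

Record chmap (R : comNzRingType) (X Y : complex R) := ChMap {
  chf :> forall i, {linear X i -> Y i};
  chf_d : forall i j x, chf j (cd X i j x) = cd Y i j (chf i x)
}.

Section Modules.
Variable R : comNzRingType.

Section Pairing.
Variables (A B C : lmodType R) (f : {linear A -> B}) (g : {linear A -> C}).
Definition pairlin (x : A) : B * C := (f x, g x).
Lemma pairlin_is_linear : linear pairlin.
Proof. by move=> a x y; rewrite /pairlin !linearP. Qed.
HB.instance Definition _ :=
  GRing.isLinear.Build R A (B * C)%type *:%R pairlin pairlin_is_linear.
End Pairing.

Section Projections.
Variables A B : lmodType R.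
Definition fstlin (p : A * B) : A := p.1.
Definition sndlin (p : A * B) : B := p.2.
Lemma fstlin_is_linear : linear fstlin. Proof. by []. Qed.
Lemma sndlin_is_linear : linear sndlin. Proof. by []. Qed.
HB.instance Definition _ :=
  GRing.isLinear.Build R (A * B)%type A *:%R fstlin fstlin_is_linear.
HB.instance Definition _ :=
  GRing.isLinear.Build R (A * B)%type B *:%R sndlin sndlin_is_linear.
End Projections.

(* The identity of X i when i = j, and 0 otherwise. *)
Section Transport.
Variables (X : int -> lmodType R) (i j : int).
Definition tr (x : X i) : X j :=
  match i =P j with
  | ReflectT e => eq_rect i (fun k => X k : Type) x j e
  | ReflectF _ => 0
  end.
Lemma tr_is_linear : linear tr.
Proof.
by rewrite /tr; case: (i =P j) => [e|_] a x y; [case: j / e | rewrite scaler0 addr0].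
Qed.
HB.instance Definition _ := GRing.isLinear.Build R (X i) (X j) *:%R tr tr_is_linear.
End Transport.
Arguments tr X i j x : clear implicits.

Lemma trE (X : int -> lmodType R) i (x : X i) : tr X i i x = x.
Proof. by rewrite /tr; case: (i =P i) => // e; rewrite (eq_irrelevance e erefl). Qed.

Lemma tr_neq (X : int -> lmodType R) i j (x : X i) : i != j -> tr X i j x = 0.
Proof. by rewrite /tr; case: (i =P j). Qed.

Lemma fgmod_prod (A B : lmodType R) : fgmod A -> fgmod B -> fgmod (A * B)%type.
Proof.
move=> [s hs] [t ht].
exists ([seq (a, 0) | a <- s] ++ [seq (0, b) | b <- t]) => -[x y].
have [c ->] := hs x; have [e ->] := ht y.
pose c' k := if insub k is Some i then c i else 0.
pose e' k := if insub k is Some i then e i else 0.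
pose h i := if (i < size s)%N then c' i else e' (i - size s)%N.
exists (fun i => h i).
rewrite [RHS](_ : _ = \sum_(0 <= i < size s + size t)
  h i *: ([seq (a, 0) | a <- s] ++ [seq (0, b) | b <- t] : seq (A * B)%type)`_i);
  last by rewrite big_mkord size_cat !size_map.
rewrite (big_cat_nat (n := size s)) ?leq_addr //=.
rewrite [X in _ = _ + X](big_addn 0 _ (size s)) addKn !big_mkord {}/h.
have -> : \sum_(i < size s)
   (if (i < size s)%N then c' i else e' (i - size s)%N) *:
      ([seq (a, 0) | a <- s] ++ [seq (0, b) | b <- t] : seq (A * B)%type)`_i
   = (\sum_i c i *: s`_i, 0).
  rewrite [RHS](linear_sum (pairlin (idfun : {linear A -> A}) (\0 : {linear A -> B}))).
  apply: eq_bigr => i _; rewrite ltn_ord nth_cat size_map ltn_ord.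
  rewrite (nth_map 0) // /c' valK.
  by congr (_, _); rewrite scaler0.
have -> : \sum_(i < size t)
   (if (i + size s < size s)%N then c' (i + size s)%N
    else e' (i + size s - size s)%N) *:
      ([seq (a, 0) | a <- s] ++ [seq (0, b) | b <- t] : seq (A * B)%type)`_(i + size s)
   = (0, \sum_i e i *: t`_i).
  rewrite [RHS](linear_sum (pairlin (\0 : {linear B -> A}) (idfun : {linear B -> B}))).
  apply: eq_bigr => i _.
  rewrite nth_cat size_map ltnNge leq_addl /= addnK (nth_map 0) // /e' valK.
  by congr (_, _); rewrite scaler0.
by congr (_, _); rewrite ?addr0 ?add0r.
Qed.

Lemma fgmod0 : fgmod 'rV[R]_0.
Proof. by exists [::] => x; exists (fun=> 0); rewrite big_ord0 thinmx0. Qed.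

End Modules.
Arguments tr [R] X i j x.

Section Constructions.
Variable R : comNzRingType.

(* X[k]^i = X^(i + k), with differential (-1)^k d. *)
Section Shift.
Variables (k : int) (X : complex R).
Definition shift_d i j : {linear X (i + k) -> X (j + k)} :=
  ((-1) ^+ `|k|%N : R) \*: cd X (i + k) (j + k).
Lemma shift_shape i j : j != i + 1 -> forall x, shift_d i j x = 0.
Proof.
move=> h x; rewrite /shift_d /= cd_shape ?scaler0 //.
by rewrite addrAC; apply: contra h => /eqP /addIr ->.
Qed.
Lemma shift_dd i j l x : shift_d j l (shift_d i j x) = 0.
Proof. by rewrite /shift_d /= linearZ /= cd_cd !scaler0. Qed.
Definition cshift := @Complex R (fun i => X (i + k)) shift_d shift_shape shift_dd.
End Shift.

Section ShiftMap.
Variables (k : int) (X Y : complex R) (f : chmap X Y).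
Lemma shift_map_d i j (x : cshift k X i) :
  f (j + k) (cd (cshift k X) i j x) = cd (cshift k Y) i j (f (i + k) x).
Proof. by rewrite /= linearZ /= chf_d. Qed.
Definition shift_map : chmap (cshift k X) (cshift k Y) :=
  @ChMap R (cshift k X) (cshift k Y) (fun i => f (i + k)) shift_map_d.
End ShiftMap.

Section DSum.
Variables X Y : complex R.
Definition dsum_d i j : {linear (X i * Y i)%type -> (X j * Y j)%type} :=
  pairlin (cd X i j \o @fstlin R (X i) (Y i)) (cd Y i j \o @sndlin R (X i) (Y i)).
Lemma dsum_shape i j : j != i + 1 -> forall x, dsum_d i j x = 0.
Proof. by move=> h x; rewrite /dsum_d /= /pairlin /= !cd_shape. Qed.
Lemma dsum_dd i j l x : dsum_d j l (dsum_d i j x) = 0.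
Proof. by rewrite /dsum_d /= /pairlin /= !cd_cd. Qed.
Definition cdsum :=
  @Complex R (fun i => (X i * Y i)%type : lmodType R) dsum_d dsum_shape dsum_dd.
End DSum.

Definition czero : complex R :=
  @Complex R (fun=> 'rV[R]_0) (fun i j => \0)
    (fun i j _ x => erefl) (fun i j l x => erefl).

(* The mapping cone: cone(f)^i = X^(i+1) x Y^i, with differential
   (x, y) |-> (- d x, f x + d y). *)
Section Cone.
Variables (X Y : complex R) (f : chmap X Y).
Definition cone_obj (i : int) : lmodType R := (X (i + 1)%R * Y i)%type.
Definition cone_d i j : {linear cone_obj i -> cone_obj j} :=
  pairlin (cd (cshift 1 X) i j \o @fstlin R (X (i + 1)) (Y i))
    ((tr Y (i + 1) j \o (f (i + 1) \o @fstlin R (X (i + 1)) (Y i)))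
     \+ (cd Y i j \o @sndlin R (X (i + 1)) (Y i))).
Lemma cone_shape i j : j != i + 1 -> forall x, cone_d i j x = 0.
Proof.
move=> h [x y]; have h1 : j + 1 != i + 1 + 1 by rewrite (inj_eq (addIr 1)).
rewrite /cone_d /= /pairlin /= /fstlin /sndlin /= (cd_shape h1) (cd_shape h).
by rewrite tr_neq 1?eq_sym // scaler0 addr0.
Qed.
Lemma cone_dd i j l x : cone_d j l (cone_d i j x) = 0.
Proof.
have [->|h] := eqVneq j (i + 1); last by rewrite (cone_shape h) linear0.
have [->|h'] := eqVneq l (i + 1 + 1); last by rewrite cone_shape.
rewrite /cone_d /= /pairlin /= expr1 !trE linearZ /= cd_cd !scaler0 linearD /=.
by rewrite cd_cd addr0 linearZ /= chf_d scaleN1r addNr.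
Qed.
Definition ccone := Complex cone_shape cone_dd.

Definition cone_in_fun i : {linear Y i -> ccone i} :=
  pairlin (\0 : {linear Y i -> X (i + 1)}) (idfun : {linear Y i -> Y i}).
Lemma cone_in_d i j y : cone_in_fun j (cd Y i j y) = cd ccone i j (cone_in_fun i y).
Proof.
by rewrite /= /pairlin /= /fstlin /sndlin /= !linear0 /= add0r.
Qed.
Definition cone_in : chmap Y ccone := ChMap cone_in_d.

Definition cone_out_fun i : {linear ccone i -> cshift 1 X i} :=
  @fstlin R (X (i + 1)) (Y i).
Lemma cone_out_d i j p :
  cone_out_fun j (cd ccone i j p) = cd (cshift 1 X) i j (cone_out_fun i p).
Proof. by []. Qed.
Definition cone_out : chmap ccone (cshift 1 X) := ChMap cone_out_d.
End Cone.

Definition cid (X : complex R) : chmap X X :=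
  @ChMap R X X (fun=> idfun) (fun i j x => erefl).

Section Comp.
Variables (X Y Z : complex R) (g : chmap Y Z) (f : chmap X Y).
Lemma ccomp_d i j x : g j (f j (cd X i j x)) = cd Z i j (g i (f i x)).
Proof. by rewrite !chf_d. Qed.
Definition ccomp : chmap X Z := @ChMap R X Z (fun i => g i \o f i) ccomp_d.
End Comp.

Definition cocycle (X : complex R) i (x : X i) : Prop := cd X i (i + 1) x = 0.

Definition cohomologous (X : complex R) i (x y : X i) : Prop :=
  exists z : X (i - 1), x - y = cd X (i - 1) i z.

(* f induces bijections on the cohomology modules. *)
Definition qis (X Y : complex R) (f : chmap X Y) : Prop :=
  forall i,
    (forall x x' : X i, cocycle x -> cocycle x' ->
       cohomologous (f i x) (f i x') -> cohomologous x x') /\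
    (forall y : Y i, cocycle y ->
       exists2 x : X i, cocycle x & cohomologous (f i x) y).

Lemma sgn_sgn_shift (k : int) (V : lmodType R) (x : V) :
  ((-1) ^+ `|k|%N : R) *: (((-1) ^+ `|k|%N : R) *: x) = x.
Proof. by rewrite scalerA -expr2 sqrr_sign scale1r. Qed.

Lemma cd_eq0 (X : complex R) i j (e : j = i + 1) x :
  cd X i j x = 0 <-> cocycle x.
Proof. by rewrite e. Qed.

Lemma im_eq (X : complex R) i l (e : l = i - 1) (u : X i) :
  (exists z, u = cd X l i z) <-> (exists z, u = cd X (i - 1) i z).
Proof. by rewrite e. Qed.

Lemma shift_cocycle k (X : complex R) i (x : cshift k X i) :
  cocycle x <-> @cocycle X (i + k) x.
Proof.
have e : i + 1 + k = i + k + 1 by rewrite addrAC.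
rewrite -(cd_eq0 e) /cocycle /=; split=> [h|->]; last by rewrite scaler0.
by rewrite -[LHS](sgn_sgn_shift k) h scaler0.
Qed.

Lemma shift_cohomologous k (X : complex R) i (x y : cshift k X i) :
  cohomologous x y <-> @cohomologous X (i + k) x y.
Proof.
have e : i - 1 + k = i + k - 1 by rewrite addrAC.
rewrite /cohomologous -(im_eq e); split=> -[z hz].
  by exists (((-1) ^+ `|k|%N : R) *: z); rewrite linearZ -/(shift_d _ _ _) hz.
exists (((-1) ^+ `|k|%N : R) *: z); rewrite /= linearZ /= sgn_sgn_shift.
exact: hz.
Qed.

Lemma qis_shift k (X Y : complex R) (f : chmap X Y) :
  qis f -> qis (shift_map k f).
Proof.
move=> hf i; have [hi hs] := hf (i + k); split.
  move=> x x' /shift_cocycle hx /shift_cocycle hx' /shift_cohomologous h.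
  by apply/shift_cohomologous; apply: hi.
move=> y /shift_cocycle /hs[x hx h]; exists x; first exact/shift_cocycle.
exact/shift_cohomologous.
Qed.

Lemma bounded_shift k (X : bcomplex R) : cbounded (cshift k X).
Proof.
have [b hb] := bcx_bounded X; exists (b + `|k|) => i hi x; apply: hb.
rewrite -(ltrD2r `|k|); apply: (lt_le_trans hi).
by rewrite -{1}[i](addrK k) -[`|k| in leRHS]normrN; apply: ler_normD.
Qed.

Lemma fg_shift k (X : bcomplex R) : cfg (cshift k X).
Proof. by move=> i; apply: bcx_fg. Qed.

Definition shift k (X : bcomplex R) : bcomplex R :=
  BComplex (@bounded_shift k X) (@fg_shift k X).

Lemma bounded_dsum (X Y : bcomplex R) : cbounded (cdsum X Y).
Proof.
have [b hb] := bcx_bounded X; have [c hc] := bcx_bounded Y.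
exists (Num.max b c) => i; rewrite gt_max => /andP[hbi hci] [x y].
by rewrite (hb _ hbi x) (hc _ hci y).
Qed.

Lemma fg_dsum (X Y : bcomplex R) : cfg (cdsum X Y).
Proof. by move=> i; apply: fgmod_prod; apply: bcx_fg. Qed.

Definition dsum (X Y : bcomplex R) : bcomplex R :=
  BComplex (@bounded_dsum X Y) (@fg_dsum X Y).

Lemma bounded_zero : cbounded czero.
Proof. by exists 0 => i _ x; apply: thinmx0. Qed.

Lemma fg_zero : cfg czero.
Proof. by move=> i; apply: fgmod0. Qed.

Definition bzero : bcomplex R := BComplex bounded_zero fg_zero.

Lemma bounded_cone (X Y : bcomplex R) (f : chmap X Y) : cbounded (ccone f).
Proof. exact: bounded_dsum (shift 1 X) Y. Qed.

Lemma fg_cone (X Y : bcomplex R) (f : chmap X Y) : cfg (ccone f).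
Proof. exact: fg_dsum (shift 1 X) Y. Qed.

Definition cone (X Y : bcomplex R) (f : chmap X Y) : bcomplex R :=
  BComplex (bounded_cone f) (fg_cone f).

(* D^b(R-mod) is the localization of the category of bounded complexes of
   finitely generated modules at the quasi-isomorphisms: its morphisms are
   formal composites of chain maps and inverses of quasi-isomorphisms,
   taken modulo the congruence deq. *)
Inductive dhom : bcomplex R -> bcomplex R -> Type :=
| dmap (X Y : bcomplex R) (f : chmap X Y) : dhom X Y
| dinv (X Y : bcomplex R) (s : chmap X Y) (hs : qis s) : dhom Y X
| dcomp (X Y Z : bcomplex R) (v : dhom Y Z) (u : dhom X Y) : dhom X Z.

Definition did (X : bcomplex R) : dhom X X := dmap (cid X).

Inductive deq : forall X Y : bcomplex R, dhom X Y -> dhom X Y -> Prop :=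
| deq_refl X Y (u : dhom X Y) : deq u u
| deq_sym X Y (u v : dhom X Y) : deq u v -> deq v u
| deq_trans X Y (u v w : dhom X Y) : deq u v -> deq v w -> deq u w
| deq_comp X Y Z (v v' : dhom Y Z) (u u' : dhom X Y) :
    deq v v' -> deq u u' -> deq (dcomp v u) (dcomp v' u')
| deq_assoc X Y Z T (w : dhom Z T) (v : dhom Y Z) (u : dhom X Y) :
    deq (dcomp w (dcomp v u)) (dcomp (dcomp w v) u)
| deq_idl X Y (u : dhom X Y) : deq (dcomp (did Y) u) u
| deq_idr X Y (u : dhom X Y) : deq (dcomp u (did X)) u
| deq_map_ext (X Y : bcomplex R) (f g : chmap X Y) :
    (forall i x, f i x = g i x) -> deq (dmap f) (dmap g)
| deq_map_comp (X Y Z : bcomplex R) (g : chmap Y Z) (f : chmap X Y) :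
    deq (dmap (ccomp g f)) (dcomp (dmap g) (dmap f))
| deq_invl (X Y : bcomplex R) (s : chmap X Y) (hs : qis s) :
    deq (dcomp (dinv hs) (dmap s)) (did X)
| deq_invr (X Y : bcomplex R) (s : chmap X Y) (hs : qis s) :
    deq (dcomp (dmap s) (dinv hs)) (did Y).

Definition is_diso X Y (u : dhom X Y) : Prop :=
  exists v : dhom Y X, deq (dcomp v u) (did X) /\ deq (dcomp u v) (did Y).

Definition diso X Y : Prop := exists u : dhom X Y, is_diso u.

Fixpoint dshift (k : int) X Y (u : dhom X Y) :
    dhom (shift k X) (shift k Y) :=
  match u in dhom X Y return dhom (shift k X) (shift k Y) with
  | dmap X Y f => @dmap (shift k X) (shift k Y) (shift_map k f)
  | dinv X Y s hs =>
      @dinv (shift k X) (shift k Y) (shift_map k s) (qis_shift k hs)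
  | dcomp X Y Z v u => dcomp (dshift k v) (dshift k u)
  end.

(* Distinguished triangles X -> Y -> Z -> X[1]: those isomorphic in
   D^b(R-mod) to a mapping cone triangle A -> B -> cone(f) -> A[1]. *)
Definition distinguished X Y Z
    (u : dhom X Y) (v : dhom Y Z) (w : dhom Z (shift 1 X)) : Prop :=
  exists (A B : bcomplex R) (f : chmap A B)
         (a : dhom A X) (b : dhom B Y) (c : dhom (cone f) Z),
    [/\ is_diso a, is_diso b & is_diso c] /\
    [/\ deq (dcomp b (dmap f)) (dcomp u a),
        deq (dcomp c (@dmap B (cone f) (cone_in f))) (dcomp v b) &
        deq (dcomp (dshift 1 a) (@dmap (cone f) (shift 1 A) (cone_out f)))
            (dcomp w c)].

Definition shift_sum (G : bcomplex R) (s : seq int) : bcomplex R :=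
  foldr (fun k X => dsum (shift k G) X) bzero s.

(* gen0 G and gen G k are the classes [G]_0 and [G]_k; the empty sum is
   allowed. *)
Definition gen0 (G F : bcomplex R) : Prop :=
  exists s : seq int, diso F (shift_sum G s).

Fixpoint gen (G : bcomplex R) (k : nat) (F : bcomplex R) : Prop :=
  match k with
  | 0%N => gen0 G F
  | j.+1 => exists (F' F0 : bcomplex R)
      (u : dhom F' F) (v : dhom F F0) (w : dhom F0 (shift 1 F')),
      [/\ gen G j F', gen0 G F0 & distinguished u v w]
  end.

(* The class <G>_n. The direct sum of complexes is also the direct sum in
   D^b(R-mod). *)
Definition thick_gen (G : bcomplex R) (n : nat) (F : bcomplex R) : Prop :=
  exists F' H : bcomplex R, gen G n H /\ diso (dsum F F') H.

Definition generated_in (n : nat) : Prop :=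
  exists G : bcomplex R, forall F : bcomplex R, thick_gen G n F.

End Constructions.

Definition Db_regular (R : comNzRingType) : Prop :=
  exists n : nat, generated_in R n.

Definition is_Db_rouquier_dim (R : comNzRingType) (d : nat) : Prop :=
  generated_in R d /\ forall n : nat, generated_in R n -> (d <= n)%N.

(* Main.v *)
Require Import Defs.
From HB Require Import structures.
From mathcomp Require Import all_boot all_order all_algebra zify.
From mathcomp Require Import boolp classical_sets.

(** The proof is a ghost lemma for Tor, followed by a passage from Tor to Ext
    that goes back to Auslander.

    Let G be a generator. Over the fraction field every complex is a direct sum
    of shifts of the field, so after clearing denominators there is a nonzero a
    such that multiplication by a on G factors, up to homotopy, through a
    complex of finite free modules with zero differential; the data behind this
    factorization are collected in [near_split], and [bcomplex_near_split]
    provides them. The same a serves all shifts of G.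

    Let C be an exact chain of finite free modules, that is, a free resolution
    of the cokernel of its first map, and let C>=j be its truncation to the
    degrees at least j. The projection from C>=j to C>=j+1 induces zero on the
    homology of a tensor product with a free module, since a cycle of C in
    positive degree is a boundary. Hence a kills the map from H(G (x) C>=j) to
    H(G (x) C>=j+1) ([kills_near_split]). An object with n + 1 layers of sums of
    shifts of G then has the map from H(X (x) C>=j) to H(X (x) C>=j+n+1) killed
    by a ^+ n.+1: one layer is used up at each step ([kills_triangle],
    [kills_thick]). For X = M in degree 0, and for k > d, a nonzero class of
    H_k(M (x) C) stays nonzero in the truncation to the degrees at least d + 1,
    so g = a ^+ d.+1 kills Tor_k(M, -) on finitely presented modules
    ([kills_tor]), for every finitely generated M.

    To reach Ext, take a free resolution of M by finite free modules, with
    matrices A_n. Dimension shift ([tor_killed_shift]) makes g kill the Tor_1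
    of the syzygy coker A_n, n >= d, with every finitely presented module. Taken
    with the transpose of this syzygy, the group Tor_1 is the group of
    endomorphisms of the syzygy modulo those factoring through a free module.
    Killing the class of the identity gives a matrix U with
    g A_n = A_n U A_n ([tor_killed_regular]), and U turns g times a cocycle of
    degree n + 1 into a coboundary ([regular_annExt]).

    The homology of X (x) C has to be a functor on the derived category, whose
    morphisms are formal composites. Each such composite acts as a relation on
    cycles modulo boundaries ([act]); the relation depends only on the class of
    the composite ([act_deq]) because quasi-isomorphisms act bijectively
    ([qis_inj], [qis_surj]). The covariant functor X (x) C is chosen instead of
    Hom(X, N) because it needs no resolution of X. *)

Set Implicit Arguments.
Unset Strict Implicit.
Unset Printing Implicit Defensive.

Import Order.TTheory GRing.Theory Num.Theory.
Local Open Scope ring_scope.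
Local Open Scope classical_set_scope.

Lemma linear_of (R : comNzRingType) (U V : lmodType R) (f : U -> V) :
  linear f -> exists g : {linear U -> V}, forall x, g x = f x.
Proof.
move=> hf; pose F := GRing.isLinear.Build R U V *:%R f hf.
by exists (HB.pack_for {linear U -> V} f F).
Qed.

(** * Matrices acting on families of vectors *)

Section MxAct.
Variable R : comNzRingType.

Definition mxact (V : lmodType R) m n (A : 'M[R]_(m, n)) (v : 'I_n -> V) :
  'I_m -> V := fun i => \sum_l A i l *: v l.

Lemma mxact_lin (V W : lmodType R) (f : {linear V -> W}) m n
    (A : 'M[R]_(m, n)) v i :
  mxact A (fun l => f (v l)) i = f (mxact A v i).
Proof. by rewrite /mxact linear_sum; apply: eq_bigr => l _; rewrite linearZ. Qed.

Lemma mxactD (V : lmodType R) a m n (A : 'M[R]_(m, n)) (v w : 'I_n -> V) i :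
  mxact A (fun l => a *: v l + w l) i = a *: mxact A v i + mxact A w i.
Proof.
rewrite /mxact scaler_sumr -big_split; apply: eq_bigr => l _ /=.
by rewrite scalerDr !scalerA mulrC.
Qed.

Lemma mxact0 (V : lmodType R) m n (A : 'M[R]_(m, n)) (v : 'I_n -> V) i :
  (forall l, v l = 0) -> mxact A v i = 0.
Proof. by move=> h; apply: big1 => l _; rewrite h scaler0. Qed.

Lemma mxactM (V : lmodType R) m n k (A : 'M[R]_(m, n)) (B : 'M[R]_(n, k))
    (v : 'I_k -> V) i :
  mxact A (mxact B v) i = mxact (A *m B) v i.
Proof.
rewrite /mxact.
under eq_bigr do rewrite scaler_sumr.
rewrite exchange_big; apply: eq_bigr => l _ /=.
by rewrite mxE scaler_suml; apply: eq_bigr => j _; rewrite scalerA.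
Qed.

Lemma mxact_mulmx m n b (A : 'M[R]_(m, n)) (B : 'M[R]_(n, b)) i :
  mxact A (fun l => row l B) i = row i (A *m B).
Proof.
apply/rowP => j; rewrite /mxact summxE !mxE; apply: eq_bigr => l _.
by rewrite !mxE.
Qed.

End MxAct.

(** * The tensor product of a complex with an exact chain *)

(** Columns are used, so that [mx p] is the map from R^(rk p.+1) to R^(rk p).
    Exactness is demanded for matrices with any number of columns, which is
    exactness after tensoring with every finite free module. *)
Record exact_chain (R : comNzRingType) := ExactChain {
  rk : nat -> nat;
  mx : forall p, 'M[R]_(rk p, rk p.+1);
  mx_cx : forall p, mx p *m mx p.+1 = 0;
  mx_exact : forall p b (v : 'M[R]_(rk p.+1, b)),
    mx p *m v = 0 -> exists w, v = mx p.+1 *m w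
}.

Section Tensor.
Variables (R : comNzRingType) (C : exact_chain R).

Section Fam.
Variable X : complex R.

(** The bigraded pieces X^q (x) C_p, with p and q unrelated: a family runs over
    all total degrees at once, which avoids transports along equalities of total
    degrees. *)
Definition fam := forall (q : int) (p : nat), 'I_(rk C p) -> X q.

HB.instance Definition _ := gen_eqMixin fam.
HB.instance Definition _ := gen_choiceMixin fam.

Lemma famP (z w : fam) : (forall q p i, z q p i = w q p i) -> z = w.
Proof.
move=> h; apply: functional_extensionality_dep => q.
apply: functional_extensionality_dep => p.
exact: functional_extensionality_dep.
Qed.

Definition fam0 : fam := fun q p i => 0.
Definition famN (z : fam) : fam := fun q p i => - z q p i.
Definition famD (z w : fam) : fam := fun q p i => z q p i + w q p i.
Definition famZ (a : R) (z : fam) : fam := fun q p i => a *: z q p i.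

Lemma famDA : associative famD.
Proof. by move=> x y z; apply: famP => q p i; apply: addrA. Qed.
Lemma famDC : commutative famD.
Proof. by move=> x y; apply: famP => q p i; apply: addrC. Qed.
Lemma fam0D : left_id fam0 famD.
Proof. by move=> x; apply: famP => q p i; apply: add0r. Qed.
Lemma famND : left_inverse fam0 famN famD.
Proof. by move=> x; apply: famP => q p i; apply: addNr. Qed.
HB.instance Definition _ := GRing.isZmodule.Build fam famDA famDC fam0D famND.

Lemma famZA a b (z : fam) : famZ a (famZ b z) = famZ (a * b) z.
Proof. by apply: famP => q p i; apply: scalerA. Qed.
Lemma fam1Z : left_id 1 famZ.
Proof. by move=> x; apply: famP => q p i; apply: scale1r. Qed.
Lemma famZDr : right_distributive famZ +%R.
Proof. by move=> a x y; apply: famP => q p i; apply: scalerDr. Qed.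
Lemma famZDl z : {morph famZ^~ z : a b / a + b}.
Proof. by move=> a b; apply: famP => q p i; apply: scalerDl. Qed.
HB.instance Definition _ :=
  GRing.Zmodule_isLmodule.Build R fam famZA fam1Z famZDr famZDl.

(** The sign sits on the chain side, where degrees are natural numbers. *)
Definition tot_fun (z : fam) : fam := fun q p i =>
  (-1) ^+ p *: cd X (q - 1) q (z (q - 1) p i) + mxact (mx C p) (z q p.+1) i.

Lemma tot_is_linear : linear tot_fun.
Proof.
move=> a z w; apply: famP => q p i; rewrite /tot_fun.
rewrite [mxact _ _ _]mxactD linearP scalerDr.
rewrite -[RHS]/(a *: (_ + _) + (_ + _)) scalerDr !scalerA mulrC.
by rewrite -!addrA; congr (_ + _); rewrite addrCA.
Qed.
HB.instance Definition _ := GRing.isLinear.Build R fam fam *:%R tot_fun tot_is_linear.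
Definition tot : {linear fam -> fam} := tot_fun.

Lemma totE (z : fam) q p i : tot z q p i =
  (-1) ^+ p *: cd X (q - 1) q (z (q - 1) p i) + mxact (mx C p) (z q p.+1) i.
Proof. by []. Qed.

Lemma totSE (z : fam) q p i : tot z (q + 1) p i =
  (-1) ^+ p *: cd X q (q + 1) (z q p i) + mxact (mx C p) (z (q + 1) p.+1) i.
Proof. by rewrite totE addrK. Qed.

Lemma tot_tot z : tot (tot z) = 0.
Proof.
apply: famP => q p i; rewrite totE totE linearD !linearZ /= cd_cd scaler0 add0r.
rewrite [X in _ + X](_ : _ = mxact (mx C p) (fun l =>
  (-1) ^+ p.+1 *: cd X (q - 1) q (z (q - 1) p.+1 l)
  + mxact (mx C p.+1) (z q p.+2) l) i) // mxactD mxactM mx_cx.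
rewrite [X in _ + (_ + X)]big1 => [|l _]; last by rewrite mxE scale0r.
by rewrite addr0 exprS mulN1r scaleNr !mxact_lin subrr.
Qed.

(** Cycles and boundaries of the quotient of X (x) C by the part of chain degree
    less than j. As the total differential at degree p only reads the degrees p
    and p + 1, the quotient is taken by ignoring small degrees, and the
    projections between these quotients are the identity on families. *)
Definition cyc j (z : fam) := forall q p i, (j <= p)%N -> tot z q p i = 0.
Definition bnd j (z : fam) :=
  exists y, forall q p i, (j <= p)%N -> z q p i = tot y q p i.

Lemma tot_ext j (z w : fam) :
  (forall q p i, (j <= p)%N -> z q p i = w q p i) ->
  forall q p i, (j <= p)%N -> tot z q p i = tot w q p i.
Proof.
move=> h q p i jp; rewrite !totE h //; congr (_ + _).
by apply: eq_bigr => l _; rewrite h // leqW.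
Qed.

Lemma cyc0 j : cyc j 0. Proof. by move=> q p i _; rewrite linear0. Qed.

Lemma cycP j a (z w : fam) : cyc j z -> cyc j w -> cyc j (a *: z + w).
Proof.
move=> hz hw q p i jp; rewrite linearP -[LHS]/(a *: tot z q p i + tot w q p i).
by rewrite hz // hw // scaler0 addr0.
Qed.

Lemma bnd0 j : bnd j 0. Proof. by exists 0 => q p i _; rewrite linear0. Qed.

Lemma bndP j a (z w : fam) : bnd j z -> bnd j w -> bnd j (a *: z + w).
Proof.
move=> [y hy] [x hx]; exists (a *: y + x) => q p i jp.
rewrite linearP -[RHS]/(a *: tot y q p i + tot x q p i).
by rewrite -[LHS]/(a *: z q p i + w q p i) hy // hx.
Qed.

Lemma bndZ j a (z : fam) : bnd j z -> bnd j (a *: z).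
Proof. by move=> h; rewrite -[_ *: _]addr0; apply: bndP => //; apply: bnd0. Qed.
Lemma bndN j (z : fam) : bnd j z -> bnd j (- z).
Proof. by move=> h; rewrite -scaleN1r; apply: bndZ. Qed.
Lemma bndD j (z w : fam) : bnd j z -> bnd j w -> bnd j (z + w).
Proof. by move=> h h'; rewrite -[z]scale1r; apply: bndP. Qed.

Lemma bnd_cyc j z : bnd j z -> cyc j z.
Proof. by move=> [y hy] q p i jp; rewrite (tot_ext hy) // tot_tot. Qed.

Lemma cyc_le j k z : (j <= k)%N -> cyc j z -> cyc k z.
Proof. by move=> jk h q p i kp; apply: h; apply: leq_trans kp. Qed.
Lemma bnd_le j k z : (j <= k)%N -> bnd j z -> bnd k z.
Proof.
by move=> jk [y h]; exists y => q p i kp; apply: h; apply: leq_trans kp.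
Qed.
Lemma bnd_tot j z : bnd j (tot z).
Proof. by exists z. Qed.

End Fam.
Arguments tot {X}.

Section FMap.
Variables (X Y : complex R) (f : chmap X Y).
Definition fmap_fun (z : fam X) : fam Y := fun q p i => f q (z q p i).
Lemma fmap_is_linear : linear fmap_fun.
Proof. by move=> a z w; apply: famP => q p i; apply: linearP. Qed.
HB.instance Definition _ :=
  GRing.isLinear.Build R (fam X) (fam Y) *:%R fmap_fun fmap_is_linear.
Definition fmap : {linear fam X -> fam Y} := fmap_fun.

Lemma fmap_tot (z : fam X) : fmap (tot z) = tot (fmap z).
Proof.
apply: famP => q p i; rewrite totE -[LHS]/(f q (_ + _)) linearD linearZ chf_d.
by rewrite -[X in _ + X]mxact_lin.
Qed.

Lemma fmap_cyc j (z : fam X) : cyc j z -> cyc j (fmap z).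
Proof.
move=> h q p i jp; rewrite -fmap_tot.
by rewrite -[LHS]/(f q (tot z q p i)) h // linear0.
Qed.
Lemma fmap_bnd j (z : fam X) : bnd j z -> bnd j (fmap z).
Proof.
move=> [y hy]; exists (fmap y) => q p i jp; rewrite -fmap_tot.
by rewrite -[LHS]/(f q (z q p i)) hy.
Qed.
End FMap.

End Tensor.
Arguments tot {R C X}.

(** * Quasi-isomorphisms induce bijections *)

Section Homology.
Variables (R : comNzRingType) (C : exact_chain R).
Local Notation fam := (fam C).

(** This is the exactness of the mapping cone of s, written without the cone. *)
Lemma qis_step (X Y : complex R) (s : chmap X Y) : qis s ->
  forall q (x : X q) (y : Y (q - 1)),
  cocycle x -> s q x = cd Y (q - 1) q y ->
  exists w : X (q - 1) * Y (q - 1 - 1),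
    x = cd X (q - 1) q w.1 /\ y = s (q - 1) w.1 + cd Y (q - 1 - 1) (q - 1) w.2.
Proof.
move=> hs q x y hx hy.
have e : q = q - 1 + 1 by rewrite subrK.
have [x1] : cohomologous x 0.
  apply: (hs q).1 => //; first exact: linear0.
  by exists y; rewrite linear0 subr0.
rewrite subr0 => hx1.
have hc : cocycle (y - s (q - 1) x1).
  by apply/(cd_eq0 e); rewrite linearB /= -hy -chf_d -hx1 subrr.
have [x2 /(cd_eq0 e) hx2 [z hz]] := (hs (q - 1)).2 _ hc.
exists (x1 + x2, - z); split=> /=; first by rewrite linearD /= hx2 addr0.
rewrite linearN /= -hz linearD /= opprB; move: (s _ x1) (s _ x2) => a b.
by rewrite -addrA [b + _]addrC subrK [a + _]addrC subrK.
Qed.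

(** Acyclicity of the cone of s tensored with C: a cycle of the cone is a
    boundary. Since X and Y are bounded, the top cochain degree of the cycle
    can be removed by [qis_step] finitely many times. The first component
    of the result gives the injectivity of s on homology, and the case x = 0
    gives its surjectivity. *)
Lemma qis_relative (X Y : bcomplex R) (s : chmap X Y) j : qis s ->
  forall (x : fam X) (y : fam Y), cyc j x ->
  (forall q p i, (j <= p)%N -> tot y q p i = s q (x q p i)) ->
  exists x' y', forall q p i, (j <= p)%N ->
    x q p i = tot x' q p i /\ y q p i = s q (x' q p i) + tot y' q p i.
Proof.
move=> hs.
have [b hbX] := bcx_bounded X; have [b' hbY] := bcx_bounded Y.
pose N : int := `|b| + `|b'| + 1.
have hX q (x : X q) : N <= `|q| -> x = 0 by move=> h; apply: hbX; lia.
have hY q (y : Y q) : N <= `|q| -> y = 0 by move=> h; apply: hbY; lia.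
suff aux (n : nat) : forall (Q : int) (x : fam X) (y : fam Y), Q = n%:Z - N ->
    (forall (q : int) p i, (j <= p)%N -> Q < q -> x q p i = 0) ->
    (forall (q : int) p i, (j <= p)%N -> Q <= q -> y q p i = 0) -> cyc j x ->
    (forall q p i, (j <= p)%N -> tot y q p i = s q (x q p i)) ->
    exists x' y', forall q p i, (j <= p)%N ->
    x q p i = tot x' q p i /\ y q p i = s q (x' q p i) + tot y' q p i.
  move=> x y cx hxy; apply: (aux `|(N + N)%R|%N N x y _ _ _ cx hxy); first by lia.
    by move=> q p i _ h; apply: hX; lia.
  by move=> q p i _ h; apply: hY; lia.
elim: n => [|n IHn] Q x y hQ vx vy cx hxy.
  exists 0, 0 => q p i jp; rewrite !linear0 /=; split.
    have [/(vx _ _ _ jp) //|h] := ltP Q q; apply: hX; lia.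
  rewrite add0r -[RHS]/(0 : Y q).
  have [/(vy _ _ _ jp) //|h] := leP Q q; apply: hY; lia.
(* The pair (x Q p i, y (Q - 1) p i) is the part of top degree of the cycle,
   so it is closed for the differential of the complexes alone. *)
have step p i : exists w : X (Q - 1) * Y (Q - 1 - 1), (j <= p)%N ->
    x Q p i = (-1) ^+ p *: cd X (Q - 1) Q w.1 /\
    y (Q - 1) p i = s (Q - 1) w.1 + (-1) ^+ p *: cd Y (Q - 1 - 1) (Q - 1) w.2.
  case: (boolP (j <= p)%N) => jp; last by exists (0, 0).
  have [||w [h1 h2]] := @qis_step X Y s hs Q ((-1) ^+ p *: x Q p i) (y (Q - 1) p i).
  - have := cx (Q + 1) p i jp; rewrite totSE mxact0 ?addr0 => [|l].
      by rewrite /cocycle linearZ.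
    by apply: vx; lia.
  - have := hxy Q p i jp; rewrite totE mxact0 ?addr0 => [h|l].
      by rewrite linearZ /= -h scalerA -expr2 sqrr_sign scale1r.
    by apply: vy; lia.
  exists (w.1, (-1) ^+ p *: w.2) => _ /=; split.
    by rewrite -h1 scalerA -expr2 sqrr_sign scale1r.
  by rewrite linearZ /= scalerA -expr2 sqrr_sign scale1r.
have {step}[w hw] : exists w : forall p, 'I_(rk C p) -> X (Q - 1) * Y (Q - 1 - 1),
    forall p i, (j <= p)%N ->
    x Q p i = (-1) ^+ p *: cd X (Q - 1) Q (w p i).1 /\
    y (Q - 1) p i = s (Q - 1) (w p i).1 +
      (-1) ^+ p *: cd Y (Q - 1 - 1) (Q - 1) (w p i).2.
  by exists (fun p i => projT1 (cid (step p i))) => p i; case: cid.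
pose x1 : fam X := fun q p i => tr X (Q - 1) q (w p i).1.
pose y1 : fam Y := fun q p i => tr Y (Q - 1 - 1) q (w p i).2.
have x1E q p i : Q - 1 < q -> x1 q p i = 0.
  by move=> h; rewrite /x1 tr_neq //; lia.
have y1E q p i : Q - 1 - 1 < q -> y1 q p i = 0.
  by move=> h; rewrite /y1 tr_neq //; lia.
have [|||||x2 [y2 h2]] := IHn (Q - 1) (x - tot x1) (y - (fmap C s x1 + tot y1)).
- by rewrite hQ; lia.
- move=> q p i jp hq; rewrite -[LHS]/(x q p i - tot x1 q p i) totE.
  rewrite mxact0 ?addr0 => [|l]; last exact: x1E.
  have [eqQ|hq'] := eqVneq q Q.
    by rewrite eqQ /x1 trE (hw p i jp).1 subrr.
  rewrite (vx _ _ _ jp); last by move/eqP: hq' => hq'; lia.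
  rewrite x1E; last by move/eqP: hq' => hq'; lia.
  by rewrite linear0 scaler0 subrr.
- move=> q p i jp hq.
  rewrite -[LHS]/(y q p i - (s q (x1 q p i) + tot y1 q p i)) totE.
  rewrite mxact0 ?addr0 => [|l]; last by apply: y1E; lia.
  have [eqQ|hq'] := eqVneq q (Q - 1).
    by rewrite eqQ /y1 /x1 !trE (hw p i jp).2 subrr.
  rewrite (vy _ _ _ jp); last by move/eqP: hq' => hq'; lia.
  have hQq : Q <= q by move/eqP: hq' => hq'; lia.
  rewrite x1E; last by lia.
  rewrite y1E; last by lia.
  by rewrite !linear0 ?scaler0 addr0 subrr.
- by rewrite addrC -scaleN1r; apply: cycP => //; apply: bnd_cyc; apply: bnd_tot.
- move=> q p i jp.
  have -> : tot (y - (fmap C s x1 + tot y1)) = tot y - fmap C s (tot x1).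
    rewrite linearB; congr (_ - _); rewrite linearD fmap_tot -[RHS]addr0.
    by congr (_ + _); apply: tot_tot.
  rewrite -[LHS]/(tot y q p i - s q (tot x1 q p i)) hxy // -linearB.
  by [].
exists (x1 + x2), (y1 + y2) => q p i jp; have [hx2 hy2] := h2 q p i jp.
split.
  rewrite linearD -[RHS]/(tot x1 q p i + tot x2 q p i) -hx2.
  by rewrite -[X in _ + X]/(x q p i - tot x1 q p i) addrC subrK.
rewrite [tot _]linearD -[X in s q X]/(x1 q p i + x2 q p i) linearD.
rewrite -[X in _ + X]/(tot y1 q p i + tot y2 q p i) addrACA -hy2.
by rewrite -[X in _ + X]/(y q p i - (s q (x1 q p i) + tot y1 q p i)) addrC subrK.
Qed.

Lemma qis_inj (X Y : bcomplex R) (s : chmap X Y) j (x : fam X) : qis s ->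
  cyc j x -> bnd j (fmap C s x) -> bnd j x.
Proof.
move=> hs cx [y hy].
have [q p i jp|x' [y' h]] := @qis_relative X Y s j hs x y cx; first by rewrite -hy.
by exists x' => q p i jp; rewrite (h q p i jp).1.
Qed.

Lemma qis_surj (X Y : bcomplex R) (s : chmap X Y) j (y : fam Y) : qis s ->
  cyc j y -> exists2 x : fam X, cyc j x & bnd j (y - fmap C s x).
Proof.
move=> hs cy.
have [q p i jp|x [y' h]] := @qis_relative X Y s j hs 0 y (@cyc0 _ _ _ _).
  by rewrite cy // [X in s _ X](_ : _ = 0) // linear0.
exists x; first by move=> q p i jp; rewrite -(h q p i jp).1.
exists y' => q p i jp.
by rewrite -[LHS]/(y q p i - s q (x q p i)) (h q p i jp).2 addrC addKr.
Qed.

End Homology.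

(** * The action of derived morphisms *)

Section Action.
Variables (R : comNzRingType) (C : exact_chain R).
Local Notation fam := (fam C).

(** An inverse of a quasi-isomorphism has no underlying map on families, so a
    morphism acts as a relation between cycles. The lemmas [act_total],
    [actP] and [act_bnd] say that this relation is the graph of a linear map on
    homology. *)
Fixpoint act j (X Y : bcomplex R) (u : dhom X Y) : fam X -> fam Y -> Prop :=
  match u in dhom X Y return fam X -> fam Y -> Prop with
  | dmap X Y f => fun z w => [/\ cyc j z, cyc j w & bnd j (w - fmap C f z)]
  | dinv X Y s _ => fun y x => [/\ cyc j y, cyc j x & bnd j (y - fmap C s x)]
  | dcomp X Y Z v u => fun z w => exists t, act j u z t /\ act j v t w
  end.

Lemma act_cyc j X Y (u : dhom X Y) z w : act j u z w -> cyc j z /\ cyc j w.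
Proof.
elim: u z w => {X Y} [X Y f|X Y s hs|X Y Z v hv u hu] z w /=.
- by case.
- by case.
- by move=> [t [/hu[hz _] /hv[_ hw]]].
Qed.

Lemma act_total j X Y (u : dhom X Y) z : cyc j z -> exists w, act j u z w.
Proof.
elim: u z => {X Y} [X Y f|X Y s hs|X Y Z v hv u hu] z hz /=.
- exists (fmap C f z); split=> //; first exact: fmap_cyc.
  by rewrite subrr; apply: bnd0.
- by have [w hw h] := qis_surj hs hz; exists w; split.
- have [t ht] := hu _ hz; have [w hw] := hv _ (act_cyc ht).2.
  by exists w, t.
Qed.

Lemma actP j X Y (u : dhom X Y) a z w z' w' :
  act j u z w -> act j u z' w' -> act j u (a *: z + z') (a *: w + w').
Proof.
elim: u z w z' w' => {X Y} [X Y f|X Y s hs|X Y Z v hv u hu] z w z' w' /=.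
- move=> [cz cw h] [cz' cw' h']; split; [exact: cycP|exact: cycP|].
  by rewrite linearP opprD addrACA -scalerBr; apply: bndP.
- move=> [cz cw h] [cz' cw' h']; split; [exact: cycP|exact: cycP|].
  by rewrite linearP opprD addrACA -scalerBr; apply: bndP.
- move=> [t [h1 h2]] [t' [h1' h2']]; exists (a *: t + t').
  by split; [apply: hu|apply: hv].
Qed.

Lemma act_bnd j X Y (u : dhom X Y) z w : act j u z w -> bnd j z -> bnd j w.
Proof.
elim: u z w => {X Y} [X Y f|X Y s hs|X Y Z v hv u hu] z w /=.
- move=> [_ _ h] hz; rewrite -[w](subrK (fmap C f z)).
  by apply: bndD => //; apply: fmap_bnd.
- move=> [_ cw h] hz; apply: (qis_inj hs cw).
  by rewrite -[fmap _ _ _](subKr z); apply: bndD => //; apply: bndN.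
- by move=> [t [/hu h1 /hv h2]] /h1 /h2.
Qed.

Lemma act_0l j X Y (u : dhom X Y) w : bnd j w -> act j u 0 w.
Proof.
move=> hw; have cw := bnd_cyc hw.
elim: u w hw cw => {X Y} [X Y f|X Y s hs|X Y Z v hv u hu] w hw cw /=.
- by split=> //; [exact: cyc0|rewrite linear0 subr0].
- by split=> //; [exact: cyc0|rewrite sub0r; apply: bndN; apply: fmap_bnd].
- by exists 0; split; [apply: hu; [exact: bnd0|exact: cyc0]|apply: hv].
Qed.

Lemma act_0r j X Y (u : dhom X Y) z : bnd j z -> act j u z 0.
Proof.
move=> hz; have [w hw] := act_total u (bnd_cyc hz).
have h0 := act_0l u (bnd0 C Y j).
have := actP (-1) (act_0l u (act_bnd hw hz)) hw.
by rewrite scaler0 add0r scaleN1r addNr.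
Qed.

(** The relation is saturated: it only sees homology classes. *)
Lemma act_compat j X Y (u : dhom X Y) z z' w w' :
  act j u z w -> bnd j (z' - z) -> bnd j (w' - w) -> act j u z' w'.
Proof.
move=> h hz hw; have := actP 1 (act_0r u hz) (actP 1 (act_0l u hw) h).
by rewrite !scale1r !add0r !subrK.
Qed.

Lemma actZ j X Y (u : dhom X Y) a z w : act j u z w -> act j u (a *: z) (a *: w).
Proof.
move=> h; have := actP a h (act_0l u (bnd0 C Y j)).
by rewrite !addr0.
Qed.

(** Naturality with respect to the projection from C>=j to C>=k. *)
Lemma act_le j k X Y (u : dhom X Y) z w :
  (j <= k)%N -> act j u z w -> act k u z w.
Proof.
move=> jk; elim: u z w => {X Y} [X Y f|X Y s hs|X Y Z v hv u hu] z w /=.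
- by move=> [? ? ?]; split; [apply: cyc_le jk _|apply: cyc_le jk _|apply: bnd_le jk _].
- by move=> [? ? ?]; split; [apply: cyc_le jk _|apply: cyc_le jk _|apply: bnd_le jk _].
- by move=> [t [/hu ? /hv ?]]; exists t.
Qed.

Lemma act_did j X z w : act j (did X) z w <-> [/\ cyc j z, cyc j w & bnd j (w - z)].
Proof. by []. Qed.

Lemma act_deq j X Y (u v : dhom X Y) : deq u v ->
  forall z w, act j u z w <-> act j v z w.
Proof.
move=> h; elim: h => {X Y u v}
  [X Y u|X Y u v _ h|X Y u v w _ h _ h'|X Y Z v v' u u' _ h _ h'
  |X Y Z T w v u|X Y u|X Y u|X Y f g h|X Y Z g f|X Y s hs|X Y s hs] z t.
- by [].
- by split=> /h.
- by split=> [/h /h'|/h' /h].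
- by split=> -[x [/h' hx /h hx']]; exists x.
- split=> /= [[x [[y [h1 h2]] h3]]|[x [h1 [y [h2 h3]]]]].
    by exists y; split=> //; exists x.
  by exists y; split=> //; exists x.
- split=> /= [[x [h1 [_ ct h2]]]|h1].
    by apply: act_compat h1 _ h2; rewrite subrr; apply: bnd0.
  have ct := (act_cyc h1).2.
  by exists t; split=> //; split=> //; rewrite subrr; apply: bnd0.
- split=> /= [[x [[cz _ h2] h1]]|h1].
    apply: act_compat h1 _ _; last by rewrite subrr; apply: bnd0.
    by rewrite -opprB; apply: bndN.
  have cz := (act_cyc h1).1.
  by exists z; split=> //; split=> //; rewrite subrr; apply: bnd0.
- have E : fmap C f z = fmap C g z by apply: famP => q p i; apply: h.
  by rewrite /= E.
- split=> /= [[cz ct h]|[x [[cz cx h1] [_ ct h2]]]].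
    have cx := fmap_cyc f cz.
    by exists (fmap C f z); split; split=> //; rewrite subrr; apply: bnd0.
  split=> //; have := bndD h2 (fmap_bnd g h1).
  by rewrite linearB addrA subrK.
- split=> [[x [[cz cx h1] [_ ct h2]]]|/act_did[cz ct h]].
    apply/act_did; split=> //; apply: (qis_inj hs).
      by rewrite addrC -scaleN1r; apply: cycP.
    by have := bndD (bndN h2) h1; rewrite opprB subrKA linearB.
  have cx := fmap_cyc s cz.
  exists (fmap C s z); split; split=> //; first by rewrite subrr; apply: bnd0.
  by rewrite -linearB; apply: fmap_bnd; rewrite -opprB; apply: bndN.
- split=> [[x [[cz cx h1] [_ ct h2]]]|/act_did[cz ct h]].
    apply/act_did; split=> //.
    by have := bndD h2 (bndN h1); rewrite opprB subrKA.
  have [x cx h1] := qis_surj hs cz.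
  exists x; split; split=> //.
  by have := bndD h h1; rewrite subrKA.
Qed.

Lemma act_iso j X Y (u : dhom X Y) : is_diso u ->
  exists v : dhom Y X,
  (forall y x w, act j v y x -> act j u x w -> bnd j (w - y)) /\
  (forall x y w, act j u x y -> act j v y w -> bnd j (w - x)).
Proof.
move=> [v [h1 h2]]; exists v; split=> [y x w hv hu|x y w hu hv].
  have /(act_deq _ h2)/act_did[] // : act j (dcomp u v) y w by exists x.
have /(act_deq _ h1)/act_did[] // : act j (dcomp v u) x w by exists y.
Qed.

Lemma iso_inj j X Y (u : dhom X Y) x y :
  is_diso u -> act j u x y -> bnd j y -> bnd j x.
Proof.
move=> /(act_iso j) [v [_ h]] hu hy.
have := h x y 0 hu (act_0r v hy).
by rewrite sub0r => /bndN; rewrite opprK.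
Qed.

Lemma iso_surj j X Y (u : dhom X Y) y : is_diso u -> cyc j y ->
  exists x, act j u x y.
Proof.
move=> /(act_iso j) [v [h _]] cy; have [x hx] := act_total v cy.
exists x; have [w hw] := act_total u (act_cyc hx).2.
apply: (act_compat hw); first by rewrite subrr; apply: bnd0.
by rewrite -opprB; apply: bndN; apply: h hx hw.
Qed.

End Action.

(** * Triangles and the ghost lemma *)

Section Cone.
Variables (R : comNzRingType) (C : exact_chain R).
Local Notation fam := (fam C).

Lemma tr_cd (X : complex R) i i' j j' (x : X i) : i = i' -> j = j' ->
  tr X j j' (cd X i j x) = cd X i' j' (tr X i i' x).
Proof. by move=> e e'; case: i' / e; case: j' / e'; rewrite !trE. Qed.

Lemma tr_chf (X Y : complex R) (f : chmap X Y) i j (x : X i) : i = j ->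
  tr Y i j (f i x) = f j (tr X i j x).
Proof. by move=> e; case: j / e; rewrite !trE. Qed.

(** If y is the boundary of (g1, g2) in the cone, then y - f g1 is the boundary
    of g2 up to signs, and the other component says that g1 is a cycle. *)
Lemma cone_exact (X Y : complex R) (f : chmap X Y) j (y : fam Y) :
  bnd j (fmap C (cone_in f) y) ->
  exists2 x : fam X, cyc j x & bnd j (y - fmap C f x).
Proof.
move=> [g hg].
have tot1 q p i : (tot g q p i).1 =
    (-1) ^+ p *: (- cd X (q - 1 + 1) (q + 1) (g (q - 1) p i).1)
    + mxact (mx C p) (fun l => (g q p.+1 l).1) i.
  rewrite (mxact_lin (@fstlin R _ _) (mx C p) (fun l => g q p.+1 l)) totE.
  by rewrite -scaleN1r.
have tot2 q p i : (tot g q p i).2 =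
    (-1) ^+ p *: (tr Y (q - 1 + 1) q (f _ (g (q - 1) p i).1)
                  + cd Y (q - 1) q (g (q - 1) p i).2)
    + mxact (mx C p) (fun l => (g q p.+1 l).2) i.
  by rewrite (mxact_lin (@sndlin R _ _) (mx C p) (fun l => g q p.+1 l)) totE.
pose x : fam X := fun q p i => (-1) ^+ p *: tr X (q - 1 + 1) q (g (q - 1) p i).1.
exists x => [q p i jp|].
  have := tot1 (q - 1) p i; rewrite -hg //= => h0.
  have {h0} := congr1 (tr X (q - 1 + 1) q) h0.
  rewrite linear0 linearD linearZ linearN /= -mxact_lin.
  rewrite (@tr_cd X _ (q - 1) _ q) ?subrK // => h.
  rewrite totE /x linearZ /= scalerA -expr2 sqrr_sign scale1r.
  rewrite (mxact_lin (((-1) ^+ p.+1 : R) \*: idfun)) /=.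
  have /eqP := esym h; rewrite addr_eq0 scalerN eqr_opp => /eqP <-.
  by rewrite exprS mulN1r scalerA mulNr -expr2 sqrr_sign scaleN1r subrr.
exists (fun q p i => (g q p i).2) => q p i jp.
have h : y q p i = (tot g q p i).2 by rewrite -hg.
rewrite -[LHS]/(y q p i - f q (x q p i)) h tot2 totE /x linearZ /= scalerDr.
by rewrite tr_chf ?subrK // [LHS]addrC !addrA addNr add0r.
Qed.

(** Exactness in the middle is carried over from the cone triangle through the
    isomorphisms a, b, c and the first two squares. *)
Lemma distinguished_exact (X Y Z : bcomplex R) (u : dhom X Y) (v : dhom Y Z)
    (w : dhom Z (shift 1 X)) j
    (y : fam Y) z : distinguished u v w -> act j v y z -> bnd j z ->
  exists x : fam X, act j u x y.
Proof.
move=> [A [B [f [a [b [c [[isoa isob isoc] [eu ev _]]]]]]]] hv hz.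
have [be hb] := iso_surj isob (act_cyc hv).1.
have cb := (act_cyc hb).1.
have hin : act j (@dmap _ B (cone f) (cone_in f)) be (fmap C (cone_in f) be).
  by split; rewrite ?subrr //; [apply: fmap_cyc|apply: bnd0].
have [t ht] := act_total c (act_cyc hin).2.
have /(act_deq _ ev) : act j (dcomp c (@dmap _ B (cone f) (cone_in f))) be t.
  by exists (fmap C (cone_in f) be).
have hvb : act j (dcomp v b) be z by exists y.
move=> hvb'; have bt : bnd j t.
  have := act_bnd (actP (-1) hvb hvb'); rewrite scaleN1r addNr => /(_ (bnd0 _ _ _)).
  by move=> /(bndD hz); rewrite scaleN1r addrA subrr add0r.
have [al ca hal] := cone_exact (iso_inj isoc ht bt).
have [x hx] := act_total a ca.
exists x.
have : act j (dcomp b (dmap f)) al y.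
  exists be; split=> //; split=> //.
move=> /(act_deq _ eu)[x' [hx' hux']].
apply: act_compat hux' _ _; last by rewrite subrr; apply: bnd0.
have := act_bnd (actP (-1) hx' hx); rewrite scaleN1r addNr => /(_ (bnd0 _ _ _)).
by rewrite scaleN1r addrC.
Qed.

(** The scalar a kills the map from H(X (x) C>=j) to H(X (x) C>=k). *)
Definition kills (X : complex R) (a : R) j k :=
  forall z : fam X, cyc j z -> bnd k (a *: z).

Lemma kills_iso (X Y : bcomplex R) a j k : (j <= k)%N ->
  diso X Y -> kills Y a j k -> kills X a j k.
Proof.
move=> jk [u hu] hY z cz; have [w hw] := act_total u cz.
apply: iso_inj hu (actZ a (act_le jk hw)) _.
by apply: hY; apply: (act_cyc hw).2.
Qed.

Lemma tot_prod (X Y : complex R) (z : fam (cdsum X Y)) q p i :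
  tot z q p i = (tot (fun q p i => (z q p i).1 : X q) q p i,
                 tot (fun q p i => (z q p i).2 : Y q) q p i).
Proof.
rewrite !totE; congr (_, _).
  by rewrite (mxact_lin (@fstlin R _ _) (mx C p) (fun l => z q p.+1 l)).
by rewrite (mxact_lin (@sndlin R _ _) (mx C p) (fun l => z q p.+1 l)).
Qed.

Lemma kills_dsum (X Y : bcomplex R) a j k :
  kills X a j k -> kills Y a j k -> kills (dsum X Y) a j k.
Proof.
move=> hX hY z cz.
have [|x hx] := hX (fun q p i => (z q p i).1).
  by move=> q p i jp; have := cz q p i jp; rewrite tot_prod => -[].
have [|y hy] := hY (fun q p i => (z q p i).2).
  by move=> q p i jp; have := cz q p i jp; rewrite tot_prod => -[].
exists (fun q p i => (x q p i, y q p i)) => q p i jp.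
by rewrite tot_prod /= -hx // -hy.
Qed.

Lemma kills_dsuml (X Y : bcomplex R) a j k :
  kills (dsum X Y) a j k -> kills X a j k.
Proof.
move=> h z cz.
have [|x hx] := h (fun q p i => (z q p i, 0)).
  move=> q p i jp; rewrite tot_prod /= [X in (X, _)]cz //.
  by congr (_, _); apply: (cyc0 (C := C) Y (j := j)).
exists (fun q p i => (x q p i).1) => q p i jp.
by have := hx q p i jp; rewrite tot_prod => -[].
Qed.

(** A class of Y, multiplied by a, dies in Z after truncation at
    j, hence comes from X there; multiplied by b, it dies after truncation
    at k. *)
Lemma kills_triangle (X Y Z : bcomplex R) (u : dhom X Y) (v : dhom Y Z)
    (w : dhom Z (shift 1 X))
    a b i j k : (i <= j)%N -> (j <= k)%N -> distinguished u v w ->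
  kills Z a i j -> kills X b j k -> kills Y (b * a) i k.
Proof.
move=> ij jk hd hZ hX y cy; have [z hz] := act_total v cy.
have [x hx] := distinguished_exact hd (actZ a (act_le ij hz)) (hZ _ (act_cyc hz).2).
rewrite -scalerA.
apply: act_bnd (actZ b (act_le jk hx)) _.
by apply: hX; apply: (act_cyc hx).1.
Qed.

Section Ghost.
Variables (G : bcomplex R) (a : R).
Hypothesis hG : forall (k : int) j, kills (shift k G) a j j.+1.

Lemma kills_gen0 X j : gen0 G X -> kills X a j j.+1.
Proof.
move=> [s hs]; apply: kills_iso hs _ => //.
elim: s => [|k s IHs]; last by apply: kills_dsum; [apply: hG|apply: IHs].
move=> z _; exists 0 => q p i _.
exact: (etrans (thinmx0 (_ : 'rV[R]_0)) (esym (thinmx0 (_ : 'rV[R]_0)))).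
Qed.

Lemma kills_gen n X j : gen G n X -> kills X (a ^+ n.+1) j (j + n.+1).
Proof.
elim: n X j => [|n IHn] X j; first by rewrite addn1; apply: kills_gen0.
move=> [X' [X0 [u [v [w [hX' hX0 hd]]]]]].
rewrite exprSr addnS -addSn.
by apply: (kills_triangle _ _ hd (kills_gen0 hX0) (IHn X' j.+1 hX')); rewrite ?leq_addr.
Qed.

Lemma kills_thick n X j : thick_gen G n X -> kills X (a ^+ n.+1) j (j + n.+1).
Proof.
move=> [X' [H [hH hX]]]; apply: (@kills_dsuml _ X').
by apply: kills_iso hX _; [rewrite leq_addr|apply: kills_gen].
Qed.
End Ghost.

End Cone.

(** * Splitting maps over a domain up to a scalar *)

Section Domain.
Variable R : idomainType.

(** A family whose images under D are independent is completed to a maximal one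
    inside l: a vector of l either adds a coordinate, or is a combination of
    the family after scaling. The maps io and pr embed the old coordinates in
    the new ones. With D the identity this provides maximal independent
    families of a module; with a general D, maximal independent families of the
    image of D together with preimages. *)
Lemma extend_indep (V W : lmodType R) (D : {linear V -> W}) (l : seq V) :
  forall r (s : {linear 'rV[R]_r -> V}), (forall x, D (s x) = 0 -> x = 0) ->
  exists r' (s' : {linear 'rV[R]_r' -> V}) (io : {linear 'rV[R]_r -> 'rV[R]_r'})
    (pr : {linear 'rV[R]_r' -> 'rV[R]_r}) (h : R),
  [/\ forall x, D (s' x) = 0 -> x = 0, forall x, s' (io x) = s x,
      forall x, pr (io x) = x, h != 0 &
      forall v, v \in l -> exists y, D (s' y) = h *: D v].
Proof.
elim: l => [|v l IHl] r s hs.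
  by exists r, s, idfun, idfun, 1; split; rewrite ?oner_neq0.
have [[c [y [c0 hy]]]|indep] :=
    pselect (exists c y, c != 0 /\ D (s y) = c *: D v).
  have [r' [s' [io [pr [h [h1 h2 h3 h4 h5]]]]]] := IHl r s hs.
  exists r', s', io, pr, (h * c); split=> //; first by rewrite mulf_neq0.
  move=> w; rewrite inE => /orP[/eqP->|/h5[y' hy']].
    by exists (h *: io y); rewrite linearZ /= h2 linearZ /= hy scalerA.
  by exists (c *: y'); rewrite linearZ /= linearZ /= hy' scalerA mulrC.
have [s1 hs1] : exists s1 : {linear 'rV[R]_(r + 1) -> V},
    forall x, s1 x = s (lsubmx x) + rsubmx x 0 0 *: v.
  apply: linear_of => a x y; rewrite !linearP !mxE scalerDl -scalerA scalerDr.
  by rewrite addrACA.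
have [io1 hio1] : exists io1 : {linear 'rV[R]_r -> 'rV[R]_(r + 1)},
    forall x, io1 x = row_mx x 0.
  by apply: linear_of => a x y; rewrite scale_row_mx add_row_mx scaler0 addr0.
have [x|r' [s' [io [pr [h [h1 h2 h3 h4 h5]]]]]] := IHl _ s1.
  rewrite hs1 linearD linearZ /= => /eqP; rewrite addr_eq0 => /eqP hx.
  have c0 : rsubmx x 0 0 = 0.
    apply/eqP/negP => /negP c0; apply: indep.
    by exists (rsubmx x 0 0), (- lsubmx x); rewrite !linearN /= hx opprK.
  rewrite -[x]hsubmxK (hs (lsubmx x)) ?hx ?c0 ?scale0r ?oppr0 //.
  suff -> : rsubmx x = 0 by rewrite row_mx0.
  by apply/rowP => i; rewrite ord1 c0 mxE.
exists r', s', (io \o io1 : {linear _ -> _}), (lsubmx \o pr : {linear _ -> _}), h.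
split=> // [x|x|w].
- by rewrite /= h2 hs1 hio1 row_mxKl row_mxKr mxE scale0r addr0.
- by rewrite /= h3 hio1 row_mxKl.
rewrite inE => /orP[/eqP->|/h5 //].
exists (h *: io (row_mx 0 1%:M)); rewrite !linearZ /= h2 hs1.
by rewrite row_mxKl row_mxKr linear0 add0r mxE eqxx scale1r.
Qed.

Lemma span_scaled (U V W : lmodType R) (D : {linear V -> W}) (b : {linear U -> W})
    (l : seq V) (h : R) :
  (forall x : V, exists c : 'I_(size l) -> R, x = \sum_i c i *: l`_i) ->
  (forall v, v \in l -> exists y, b y = h *: D v) ->
  forall v, exists y, b y = h *: D v.
Proof.
move=> hl hb v; have [c ->] := hl v.
apply: (big_ind (fun v => exists y, b y = h *: D v)) => [|x y [x' hx] [y' hy]|i _].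
- by exists 0; rewrite linear0 [D 0]linear0 scaler0.
- by exists (x' + y'); rewrite linearD [D _]linearD hx hy scalerDr.
- have [y hy] := hb _ (mem_nth 0 (ltn_ord i)).
  by exists (c i *: y); rewrite !linearZ /= hy !scalerA mulrC.
Qed.

Lemma linear_coord (U W : lmodType R) (b : {linear U -> W}) (h : R) :
  (forall x, b x = 0 -> x = 0) -> (forall w, exists y, b y = h *: w) ->
  exists c : {linear W -> U}, forall w, b (c w) = h *: w.
Proof.
move=> binj hb.
pose c w := projT1 (cid (hb w)).
have hc w : b (c w) = h *: w by rewrite /c; case: cid.
have [|c' hc'] := @linear_of R W U c; last by exists c' => w; rewrite hc'.
move=> a x y; apply/eqP; rewrite -subr_eq0; apply/eqP/binj.
rewrite linearB linearP !hc scalerDr !scalerA mulrC.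
exact: subrr.
Qed.

(** Inverting one suitable nonzero scalar makes a finitely generated module free:
    a and b are its coordinates and its basis, with the denominator cleared. *)
Lemma fg_factor (V : lmodType R) : fgmod V ->
  exists h : R, h != 0 /\ exists r (a : {linear V -> 'rV[R]_r})
    (b : {linear 'rV[R]_r -> V}), forall x, b (a x) = h *: x.
Proof.
move=> [l hl].
have [x _|r [b [_ [_ [h [binj _ _ h0 hb]]]]]] :=
  @extend_indep V V idfun l 0 (\0 : {linear 'rV[R]_0 -> V}).
  exact: thinmx0.
exists h; split=> //; exists r.
have [a ha] := linear_coord binj (span_scaled (D := idfun) (b := b) hl hb).
by exists a, b.
Qed.

(** Over a field every linear map has a generalized inverse. Here a maximal
    independent family of the image is extended to one of W; the inverse sends
    the vectors of the first family to their preimages and the others to 0. *)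
Lemma fg_ginv (V W : lmodType R) (D : {linear V -> W}) : fgmod V -> fgmod W ->
  exists h : R, h != 0 /\ exists s : {linear W -> V},
    forall x, D (s (D x)) = h *: D x.
Proof.
move=> [lV hV] [lW hW].
have [x _|r1 [s1 [_ [_ [h1 [inj1 _ _ h10 hs1]]]]]] :=
  @extend_indep V W D lV 0 (\0 : {linear 'rV[R]_0 -> V}).
  exact: thinmx0.
have {}hs1 := span_scaled (b := D \o s1 : {linear _ -> _}) hV hs1.
have [//|r2 [b [io [pr [h2 [inj2 hbio hprio h20 hb]]]]]] :=
  @extend_indep W W idfun lW r1 (D \o s1 : {linear _ -> _}).
have [c hc] := linear_coord inj2 (span_scaled (D := idfun) (b := b) hW hb).
exists h2; split=> //; exists (s1 \o (pr \o c) : {linear _ -> _}) => x /=.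
have [y /= hy] := hs1 x.
have e : h1 *: c (D x) = h2 *: io y.
  apply/eqP; rewrite -subr_eq0; apply/eqP/inj2.
  by rewrite linearB !linearZ /= hc hbio /= hy scalerN !scalerA mulrC subrr.
have e' : io (pr (c (D x))) = c (D x).
  apply: (scalemx_inj h10).
  by have := congr1 (fun z => io (pr z)) e; rewrite !linearZ /= hprio -e.
by rewrite -hc -[in RHS]e' hbio.
Qed.

End Domain.

(** * Complexes that split up to a scalar *)

(** For f = 1 the first condition says that the complex is homotopy equivalent to
    its cohomology, and the second one that its terms are finitely generated
    and projective. *)
Definition near_split (R : comNzRingType) (X : complex R) (f : R) :=
  (forall i j, exists s : {linear X j -> X i},
     forall x, cd X i j (s (cd X i j x)) = f *: cd X i j x) /\
  (forall i, exists r (a : {linear X i -> 'rV[R]_r}) (b : {linear 'rV[R]_r -> X i}),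
     forall x, b (a x) = f *: x).

Lemma near_split_shift (R : comNzRingType) (X : complex R) f k :
  near_split X f -> near_split (cshift k X) f.
Proof.
move=> [hs hb]; split=> [i j|i]; last exact: hb.
have [s h] := hs (i + k) (j + k).
exists (((-1) ^+ `|k|%N : R) \*: s) => x.
by rewrite /= !linearZ /= sgn_sgn_shift h scalerA mulrC -scalerA.
Qed.

Section NearSplit.
Variable R : idomainType.

(** One scalar can be chosen for all degrees, since only finitely many of them
    impose a condition. *)
Lemma common_multiple (P : int -> R -> Prop) (N : int) :
  (forall i g h, P i h -> P i (g * h)) -> (forall i, N < `|i| -> P i 1) ->
  (forall i, exists2 h, h != 0 & P i h) -> exists2 h, h != 0 & forall i, P i h.
Proof.
move=> hM h1 hP.
suff [h h0 hh] : exists2 h, h != 0 & forall i : int, `|i| <= `|N| -> P i h.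
  exists h => // i; have [/hh //|hi] := lerP `|i| `|N|.
  by rewrite -[h]mulr1; apply: hM; apply: h1; lia.
rewrite -abszE; elim: `|N|%N => [|n [h h0 hh]].
  have [h h0 hh] := hP 0; exists h => // i hi.
  by have -> : i = 0 by lia.
have [g g0 hg] := hP n.+1%:Z; have [g' g0' hg'] := hP (- n.+1%:Z).
exists (g' * (g * h)) => [|i hi]; first by rewrite !mulf_neq0.
have [hi'|hi'] := lerP `|i| n%:Z; first by apply/hM/hM/hh.
have [->|->] : i = n.+1%:Z \/ i = - n.+1%:Z by lia.
  by apply: (hM); rewrite mulrC; apply: (hM).
by rewrite mulrC; apply: (hM).
Qed.

Lemma bcomplex_near_split (X : bcomplex R) : exists2 f, f != 0 & near_split X f.
Proof.
have [N hN] := bcx_bounded X.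
pose P i f := (exists s : {linear X (i + 1) -> X i},
     forall x, cd X i (i + 1) (s (cd X i (i + 1) x)) = f *: cd X i (i + 1) x) /\
  (exists r (a : {linear X i -> 'rV[R]_r}) (b : {linear 'rV[R]_r -> X i}),
     forall x, b (a x) = f *: x).
suff [f f0 hf] : exists2 f, f != 0 & forall i, P i f.
  exists f => //; split=> i; last by have [] := hf i.
  move=> j; have [->|hj] := eqVneq j (i + 1); first by have [] := hf i.
  by exists \0 => x; rewrite !cd_shape // scaler0.
apply: (common_multiple (N := N)) => [i g h|i hi|i].
- move=> [[s hs] [r [a [b hab]]]]; split.
    by exists (g \*: s) => x; rewrite /= linearZ /= hs scalerA.
  exists r, a, (g \*: b : {linear _ -> _}) => x.
  by rewrite /= hab scalerA.
- split; first by exists \0 => x; rewrite (hN _ hi x) !linear0 ?scaler0.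
  by exists 0, \0, \0 => x; rewrite (hN _ hi x) scaler0.
- have [h [h0 [s hs]]] := fg_ginv (cd X i (i + 1)) (bcx_fg X i) (bcx_fg X (i + 1)).
  have [g [g0 [r [a [b hab]]]]] := fg_factor (bcx_fg X i).
  exists (g * h); first by rewrite mulf_neq0.
  split; first by exists (g \*: s) => x; rewrite /= linearZ /= hs scalerA.
  exists r, a, (h \*: b : {linear _ -> _}) => x.
  by rewrite /= hab scalerA mulrC.
Qed.

End NearSplit.

Lemma exact_rV (R : comNzRingType) (C : exact_chain R) r p
    (v : 'I_(rk C p.+1) -> 'rV[R]_r) : (forall i, mxact (mx C p) v i = 0) ->
  exists w, forall i, v i = mxact (mx C p.+1) w i.
Proof.
move=> hv; pose m := \matrix_i v i.
have hm l : v l = row l m by rewrite rowK.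
have [|W hW] := @mx_exact _ C p r m.
  apply/row_matrixP => i; rewrite -mxact_mulmx row0 -(hv i).
  by apply: eq_bigr => l _; rewrite hm.
exists (fun l => row l W) => i.
by rewrite mxact_mulmx -hW hm.
Qed.

(** Let theta = f - d s - s d, a map homotopic to f with theta d = d theta = 0.
    Then f^3 is homotopic to f theta theta = theta b a theta, which
    factors through free modules with zero differential. There, a cycle of the
    tensor product is made of cycles of C, and these are boundaries of C in
    positive degree. *)
Lemma kills_near_split (R : comNzRingType) (C : exact_chain R) (X : complex R) f j :
  near_split X f -> kills C X (f * (f * f)) j j.+1.
Proof.
move=> [hs hb] z cz.
have {hs} [s hsc] : exists s : forall i k, {linear X k -> X i}, forall i k x,
    cd X i k (s i k (cd X i k x)) = f *: cd X i k x.
  by exists (fun i k => projT1 (cid (hs i k))) => i k x; case: cid.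
have [th hth] : exists th : forall q, {linear X q -> X q}, forall q x, th q x =
    f *: x - cd X (q - 1) q (s (q - 1) q x) - s q (q + 1) (cd X q (q + 1) x).
  pose L q := f \*: idfun \- (cd X (q - 1) q \o s (q - 1) q)
              \- (s q (q + 1) \o cd X q (q + 1)) : {linear X q -> X q}.
  by exists L.
have th_cd q k x : th k (cd X q k x) = 0.
  have [->|hk] := eqVneq k (q + 1); last by rewrite cd_shape // linear0.
  by rewrite hth cd_cd linear0 subr0 addrK hsc subrr.
have cd_th q k x : cd X q k (th q x) = 0.
  have [->|hk] := eqVneq k (q + 1); last by rewrite cd_shape.
  by rewrite hth !linearB /= linearZ /= cd_cd subr0 hsc subrr.
have tot_th (w : fam C X) q p i :
    tot (fun q p i => th q (w q p i) : X q) q p i = th q (tot w q p i).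
  rewrite !totE cd_th scaler0 add0r mxact_lin linearD linearZ /= th_cd.
  by rewrite scaler0 add0r.
(* The sign makes s a homotopy for the total differential, where d carries the
   same sign. *)
pose y : fam C X := fun q p i => (-1) ^+ p *: s q (q + 1) (z (q + 1) p i).
have hy q p i : (j <= p)%N -> f *: z q p i = th q (z q p i) + tot y q p i.
  move=> jp; rewrite hth totE /y linearZ /= scalerA -expr2 sqrr_sign scale1r.
  rewrite (subrK 1 q).
  rewrite (mxact_lin (((-1) ^+ p.+1 : R) \*: s q (q + 1))) /=.
  have := cz (q + 1) p i jp; rewrite totSE => /eqP.
  rewrite addr_eq0 => /eqP e; rewrite -[mxact _ _ _]opprK -e.
  rewrite linearN linearZ /= exprS mulN1r scaleNr scalerN opprK scalerA.
  rewrite -expr2 sqrr_sign scale1r.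
  move: (cd X (q - 1) q _) (s q (q + 1) _) => u v.
  by rewrite -[_ - u - v]addrA -opprD subrK.
(* Each a (th z) is a cycle of C tensored with a free module; v is b applied to
   a preimage under the differential of C. *)
have [v hv] : exists v : forall q p, 'I_(rk C p.+1) -> X q, forall q p i,
    (j < p)%N -> f *: th q (th q (z q p i)) =
                 mxact (mx C p) (fun l => th q (v q p l)) i.
  suff h q p : exists v : 'I_(rk C p.+1) -> X q, forall i, (j < p)%N ->
      f *: th q (th q (z q p i)) = mxact (mx C p) (fun l => th q (v l)) i.
    exists (fun q p => projT1 (cid (h q p))) => q p i jp.
    by case: cid => v /= ->.
  have [r [a [b hab]]] := hb q.
  case: p => [|p]; first by exists (fun=> 0).
  have [jp|jp] := boolP (j < p.+1)%N; last by exists (fun=> 0).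
  have [i|w hw] := @exact_rV R C r p (fun l => a (th q (z q p.+1 l))).
    rewrite (mxact_lin (a \o th q : {linear _ -> _})) /=.
    have := cz q p i jp; rewrite totE => /eqP.
    rewrite addr_eq0 => /eqP e; rewrite -[mxact _ _ _]opprK -e.
    by rewrite linearN linearZ /= th_cd scaler0 oppr0 linear0.
  exists (fun l => b (w l)) => i _.
  rewrite -linearZ /= -hab hw.
  by rewrite (mxact_lin (th q \o b : {linear _ -> _})).
pose y2 : fam C X := fun q p =>
  match p with 0%N => fun=> 0 | p'.+1 => fun i => th q (v q p' i) end.
pose ty : fam C X := fun q p i => th q (y q p i).
exists (y2 + f *: (ty + f *: y)) => q p i jp.
have -> : tot (y2 + f *: (ty + f *: y)) =
    tot y2 + f *: (tot ty + f *: tot y) :> fam C X.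
  by rewrite linearD; congr (_ + _); rewrite linearZ /=; congr (_ *: _);
     rewrite linearD; congr (_ + _); rewrite linearZ.
rewrite -[RHS]/(tot y2 q p i + f *: (tot ty q p i + f *: tot y q p i)).
rewrite tot_th.
have -> : tot y2 q p i = f *: th q (th q (z q p i)).
  rewrite hv // totE; case: p jp i => // p jp i.
  by rewrite /= cd_th scaler0 add0r.
rewrite -[LHS]/((f * (f * f)) *: z q p i) -!scalerA hy ?(ltnW jp) //.
have e : f *: th q (z q p i) = th q (th q (z q p i)) + th q (tot y q p i).
  by rewrite -linearD -hy ?(ltnW jp) // linearZ.
by rewrite [f *: (_ + _)]scalerDr e -addrA scalerDr.
Qed.

(** * Free resolutions over a Noetherian ring *)

Section Noetherian.
Variable R : comNzRingType.
Hypothesis noethR : noetherian R.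

(** Induction on the number of generators of the ambient module: the leading
    coefficients of the elements of S form an ideal I0. Elements u of S that
    realize generators of I0, and generators h of the elements of S with zero
    leading coefficient, generate S together. *)
Lemma noetherian_sub (V : lmodType R) n (g : 'I_n -> V) (S : V -> Prop) :
  S 0 -> (forall a x y, S x -> S y -> S (a *: x + y)) ->
  (forall x, S x -> exists c : 'I_n -> R, x = \sum_i c i *: g i) ->
  exists (I : finType) (h : I -> V), (forall i, S (h i)) /\
    forall x, S x -> exists c : I -> R, x = \sum_i c i *: h i.
Proof.
elim: n g S => [|n IHn] g S S0 SP hg.
  exists void, (fun x : void => match x with end); split=> // x /hg[c ->].
  by exists (fun=> 0); rewrite big_ord0 big1.
pose g' i := g (lift ord0 i).
pose I0 : set R := fun a => exists c : 'I_n -> R, S (a *: g ord0 + \sum_i c i *: g' i).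
have sumP a (c e : 'I_n -> R) : \sum_i (a * c i + e i) *: g' i =
    a *: \sum_i c i *: g' i + \sum_i e i *: g' i.
  rewrite scaler_sumr -big_split; apply: eq_bigr => i _ /=.
  by rewrite scalerDl scalerA.
have I0P a x y : I0 x -> I0 y -> I0 (a * x + y).
  move=> [c hc] [e he]; exists (fun i => a * c i + e i).
  by rewrite sumP scalerDl -scalerA addrACA -scalerDr; apply: SP.
have I00 : I0 0.
  by exists (fun=> 0); rewrite scale0r add0r big1 // => i _; rewrite scale0r.
have [|s hs] := @noethR I0.
  split=> // [x y hx hy|a x hx]; first by rewrite -[x]mul1r; apply: I0P.
  by rewrite -[_ * _]addr0; apply: I0P.
have hI (i : 'I_(size s)) : I0 s`_i.
  rewrite hs; exists (fun j => (j == i)%:R).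
  rewrite (bigD1 i) //= eqxx mul1r big1 ?addr0 // => j /negPf ->.
  by rewrite mul0r.
pose c i := projT1 (cid (hI i)).
pose u (i : 'I_(size s)) := s`_i *: g ord0 + \sum_l c i l *: g' l.
have Su i : S (u i) by rewrite /u /c; case: cid.
have Ssum (e : 'I_(size s) -> R) : S (\sum_i e i *: u i).
  apply: (big_ind S) => // [x y Sx Sy|i _].
    by rewrite -[x]scale1r; apply: SP.
  by rewrite -[_ *: _]addr0; apply: SP.
have [||x [_ hx] //|J [h [Sh hh]]] :=
  IHn g' (fun x => S x /\ exists c : 'I_n -> R, x = \sum_i c i *: g' i).
- by split=> //; exists (fun=> 0); rewrite big1 // => i _; rewrite scale0r.
- move=> a x y [Sx [b hb]] [Sy [e he]]; split; first exact: SP.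
  by exists (fun i => a * b i + e i); rewrite sumP hb he.
exists ('I_(size s) + J)%type,
  (fun k => match k with inl i => u i | inr j => h j end).
split=> [[i|j]|x Sx]; [exact: Su|exact: (Sh j).1|].
have [b hb] := hg x Sx.
have : I0 (b ord0).
  by exists (fun i => b (lift ord0 i)); rewrite hb big_ord_recl in Sx.
rewrite hs => -[e he].
have [|k hk] := hh (x - \sum_i e i *: u i).
  split; first by rewrite addrC -scaleN1r; apply: SP.
  exists (fun l => - (\sum_i e i * c i l) + b (lift ord0 l)).
  rewrite hb big_ord_recl he.
  have -> : \sum_i e i *: u i = (\sum_i e i * s`_i) *: g ord0 +
      \sum_l (\sum_i e i * c i l) *: g' l.
    rewrite scaler_suml.
    under [X in _ = _ + X]eq_bigr do rewrite scaler_suml.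
    rewrite exchange_big -big_split; apply: eq_bigr => i _ /=.
    rewrite scalerDr scalerA scaler_sumr; congr (_ + _).
    by apply: eq_bigr => l _; rewrite scalerA.
  rewrite opprD addrACA subrr add0r addrC -sumrN -big_split.
  by apply: eq_bigr => l _; rewrite scalerDl scaleNr.
exists (fun k' => match k' with inl i => e i | inr j => k j end).
by rewrite big_sumType /= -hk addrC subrK.
Qed.

Lemma syzygies n (V : lmodType R) (f : {linear 'rV[R]_n -> V}) :
  exists l (B : 'M[R]_(l, n)), forall x, f x = 0 <-> exists y, x = y *m B.
Proof.
have [|a x y fx fy|x _|I [h [hI hh]]] :=
  @noetherian_sub 'rV[R]_n n (fun i => delta_mx 0 i) (fun x => f x = 0).
- exact: linear0.
- by rewrite linearP fx fy scaler0 addr0.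
- by exists (x 0); apply: row_sum_delta.
exists #|I|, (\matrix_i h (enum_val i)) => x; split=> [/hh[c ->]|[y ->]].
  exists (\row_i c (enum_val i)); rewrite mulmx_sum_row.
  rewrite (reindex (@enum_val I I)) /=; last first.
    exact: (onW_bij _ (@enum_val_bij I)).
  by apply: eq_bigr => i _; rewrite mxE rowK.
rewrite mulmx_sum_row linear_sum big1 // => i _.
by rewrite linearZ /= rowK hI scaler0.
Qed.

(** The predicate P stands for the equality of A 0 with A0, whose two sides have
    distinct dependent types. *)
Lemma syzygy_chain m n (A0 : 'M[R]_(m, n)) (P : forall m n, 'M[R]_(m, n) -> Prop) :
  P m n A0 -> exists q (A : forall p, 'M[R]_(q p.+1, q p)), P _ _ (A 0%N) /\
    forall p b (X : 'M_(b, q p.+1)), X *m A p = 0 <-> exists Y, X = Y *m A p.+1.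
Proof.
move=> hP.
pose T := {mn : nat * nat & 'M[R]_(mn.1, mn.2)}.
have hnext (t : T) : exists t' : {l : nat & 'M[R]_(l, (projT1 t).1)},
    forall x : 'rV_ _, x *m projT2 t = 0 <-> exists y, x = y *m projT2 t'.
  have [l [B hB]] := syzygies (mulmxr (projT2 t) : {linear 'rV_ _ -> 'rV_ _}).
  by exists (existT _ l B).
(* The state is a matrix with its two sizes. The new second size is, by
   conversion, the old first size, so consecutive matrices compose. *)
pose next (t : T) : T := let t' := projT1 (cid (hnext t)) in
  existT (fun mn : nat * nat => 'M[R]_(mn.1, mn.2)) (projT1 t', (projT1 t).1) (projT2 t').
pose st p : T := iter p next (existT _ (m, n) A0).
exists (fun p => (projT1 (st p)).2), (fun p => projT2 (st p)); split=> // p b X.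
have hx (x : 'rV_ _) : x *m projT2 (st p) = 0 <-> exists y, x = y *m projT2 (st p.+1).
  by rewrite /= /next /=; case: cid.
split=> [h|[Y ->]].
  have hr i : exists y, row i X = y *m projT2 (st p.+1).
    by apply/hx; rewrite -row_mul h row0.
  exists (\matrix_i projT1 (cid (hr i))); apply/row_matrixP => i.
  by rewrite row_mul rowK; case: cid.
apply/row_matrixP => i; rewrite !row_mul row0.
by apply/hx; exists (row i Y).
Qed.

Lemma exact_chain_from m n (E0 : 'M[R]_(m, n)) (P : forall m n, 'M[R]_(m, n) -> Prop) :
  P m n E0 -> exists C : exact_chain R, P _ _ (mx C 0%N).
Proof.
move=> hP.
have [|q [A [hA ex]]] := @syzygy_chain _ _ E0^T (fun a b B => P b a B^T).
  by rewrite trmxK.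
have cx p : (A p)^T *m (A p.+1)^T = 0.
  rewrite -trmx_mul -(trmx0 R); congr trmx; apply/ex.
  by exists 1%:M; rewrite mul1mx.
have exC p b (v : 'M_(q p.+1, b)) : (A p)^T *m v = 0 ->
    exists w, v = (A p.+1)^T *m w.
  move=> /(congr1 trmx); rewrite trmx_mul trmxK trmx0 => /ex[Y hY].
  by exists Y^T; rewrite -trmx_mul -hY trmxK.
by exists (ExactChain cx exC).
Qed.

Lemma free_resolution (M : lmodType R) : fgmod M ->
  exists q (A : forall p, 'M[R]_(q p.+1, q p)) (ep : {linear 'rV[R]_(q 0%N) -> M}),
  [/\ forall y, exists x, ep x = y,
      forall x, ep x = 0 <-> exists z, x = z *m A 0%N &
      forall p b (X : 'M_(b, q p.+1)), X *m A p = 0 <-> exists Y, X = Y *m A p.+1].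
Proof.
move=> [s hs].
have [ep hep] : exists ep : {linear 'rV[R]_(size s) -> M},
    forall x, ep x = \sum_i x 0 i *: s`_i.
  apply: linear_of => a x y; rewrite scaler_sumr -big_split.
  by apply: eq_bigr => i _; rewrite !mxE scalerDl scalerA.
have [l [B hB]] := syzygies ep.
have [|q [A [[ep' [h1 h2]] h3]]] := @syzygy_chain _ _ B (fun _ n B =>
  exists ep : {linear 'rV[R]_n -> M}, (forall y, exists x, ep x = y) /\
    (forall x, ep x = 0 <-> exists z, x = z *m B)).
  exists ep; split=> // y; have [c ->] := hs y; exists (\row_i c i).
  by rewrite hep; apply: eq_bigr => i _; rewrite mxE.
by exists q, A, ep'; split.
Qed.

End Noetherian.

(** * From modules in degree 0 to Tor *)

Section Single.
Variables (R : comNzRingType) (M : lmodType R) (fgM : fgmod M).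

Definition single_obj (q : int) : lmodType R :=
  match q with Posz 0 => M | _ => 'rV[R]_0 end.

Definition single_complex : complex R :=
  @Complex R single_obj (fun i j => \0) (fun i j _ x => erefl) (fun i j l x => erefl).

Lemma single_bounded : cbounded single_complex.
Proof. by exists 0 => -[[|n]|n] // _ x; apply: thinmx0. Qed.

Lemma single_fg : cfg single_complex.
Proof. by move=> [[|n]|n] //; apply: fgmod0. Qed.

Definition single : bcomplex R := BComplex single_bounded single_fg.

(** A cycle of M (x) C of chain degree k.+1 >= d is seen by C>=d, and a boundary
    there is a boundary in M (x) C. *)
Lemma kills_single (C : exact_chain R) (g : R) d k (v : 'I_(rk C k.+1) -> M) :
  kills C single g 0 d -> (d <= k.+1)%N -> (forall i, mxact (mx C k) v i = 0) ->
  exists w : 'I_(rk C k.+2) -> M, forall i, g *: v i = mxact (mx C k.+1) w i.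
Proof.
move=> hk dk hv.
pose z0 p (i : 'I_(rk C p)) : M := match p =P k.+1 with
  | ReflectT e => v (cast_ord (congr1 (rk C) e) i) | ReflectF _ => 0 end.
pose z : fam C single_complex := fun q p i =>
  match q return single_obj q with Posz 0 => z0 p i | _ => 0 end.
have zk i : z0 k.+1 i = v i.
  by rewrite /z0; case: eqP => // e; congr v; apply: val_inj.
have [q p i _|y hy] := hk z.
  rewrite totE /= scaler0 add0r; case: q => [[|q]|q];
    [|by apply: mxact0|by apply: mxact0].
  have [e|e] := eqVneq p k.
    by move: i; rewrite e => i; rewrite -[RHS](hv i); apply: eq_bigr => l _; rewrite -zk.
  by apply: mxact0 => l; rewrite /z /z0; case: eqP => // e'; have [e1] := e';
     rewrite e1 eqxx in e.
exists (y 0 k.+2) => i; have := hy 0 k.+1 i dk.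
by rewrite totE /= scaler0 add0r -zk.
Qed.

End Single.

(** * Dimension shift and the transpose of a syzygy *)

Section Auslander.
Variable R : comNzRingType.

(** With A a presentation of a module L (rows are relations), this says that g
    kills Tor_(k+1) of L and of the cokernel of [mx C 0]. A family of elements
    of L is given by representatives, the rows of v. *)
Definition tor_killed (C : exact_chain R) (g : R) a b (A : 'M[R]_(a, b)) k :=
  forall v : 'M_(rk C k.+1, b), (exists U, mx C k *m v = U *m A) ->
  exists W U, g *: v = mx C k.+1 *m W + U *m A.

Lemma kills_tor (M : lmodType R) (fgM : fgmod M) (C : exact_chain R) g d a n
    (A : 'M[R]_(a, n)) (ep : {linear 'rV[R]_n -> M}) k :
  kills C (single fgM) g 0 d -> (d <= k.+1)%N ->
  (forall y, exists x, ep x = y) ->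
  (forall x, ep x = 0 <-> exists z, x = z *m A) ->
  tor_killed C g A k.
Proof.
move=> hk dk surj ker v [U hU].
have [i|w hw] := @kills_single R M fgM C g d k (fun l => ep (row l v)) hk dk.
  rewrite (mxact_lin ep) mxact_mulmx hU row_mul.
  by apply/ker; exists (row i U).
pose W := \matrix_l projT1 (cid (surj (w l))).
have hW l : ep (row l W) = w l by rewrite rowK; case: cid.
have hz i : exists z, g *: row i v - row i (mx C k.+1 *m W) = z *m A.
  apply/ker; rewrite linearB linearZ /= hw -mxact_mulmx -mxact_lin.
  by rewrite [X in _ - X](_ : _ = mxact (mx C k.+1) w i) ?subrr //;
     apply: eq_bigr => l _; rewrite hW.
exists W, (\matrix_i projT1 (cid (hz i))); apply/row_matrixP => i.
rewrite linearZ linearD /= [row i (_ *m A)]row_mul rowK; case: cid => x /= <-.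
by rewrite addrC subrK.
Qed.

(** The usual chase for Tor_(k+2)(L) = Tor_(k+1)(L'), where L' is the image of A,
    presented by A': the cycle v of L' is, in the free module, the boundary of a
    chain y, and y is a cycle of L. *)
Lemma tor_killed_shift C g a b c (A : 'M[R]_(a, b)) (A' : 'M[R]_(c, a)) k :
  (forall n (X : 'M_(n, a)), X *m A = 0 <-> exists Y, X = Y *m A') ->
  tor_killed C g A k.+1 -> tor_killed C g A' k.
Proof.
move=> ex hA v [U hU].
have A'A : A' *m A = 0 by apply/ex; exists 1%:M; rewrite mul1mx.
have [|y hy] := @mx_exact _ C k _ (v *m A).
  by rewrite mulmxA hU -mulmxA A'A mulmx0.
have [|W [U' hW]] := hA y; first by exists v.
have /ex[V hV] : (g *: v - mx C k.+1 *m U') *m A = 0.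
  rewrite mulmxBl -scalemxAl hy scalemxAr hW mulmxDr mulmxA mx_cx mul0mx add0r.
  by rewrite mulmxA subrr.
by exists U', V; rewrite -hV addrC subrK.
Qed.

(** Choose C to begin with A itself. The rows of the identity matrix represent
    the tautological cycle in Tor_1 of coker A and its transpose; the
    matrix U comes from writing g times this cycle as a boundary. *)
Lemma tor_killed_regular g a b (A : 'M[R]_(a, b)) : noetherian R ->
  (forall C, tor_killed C g A 0) -> exists U, g *: A = A *m U *m A.
Proof.
move=> hN hA.
have [|C [X [hX hP]]] := @exact_chain_from R hN a b A (fun m n E =>
  exists X : 'M_(n, b), (exists U, E *m X = U *m A) /\
    forall U' : 'M_(n, a), g *: (E *m X) = E *m U' *m A ->
    exists U, g *: A = A *m U *m A).
  exists 1%:M; split; first by exists 1%:M; rewrite mulmx1 mul1mx.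
  by move=> U; rewrite mulmx1; exists U.
have [W [U hU]] := hA C X hX; apply: (hP U).
by rewrite scalemxAr hU mulmxDr mulmxA mx_cx mul0mx add0r mulmxA.
Qed.

End Auslander.

(** * Comparison of projective resolutions *)

Section Comparison.
Variable R : comNzRingType.

(** Projectivity lifts along surjections only; lifting along an exact sequence
    goes through the kernel, as a module of its own. *)
Section Kernel.
Variables (A B : lmodType R) (f : {linear A -> B}).
Definition ker_pred : {pred A} := fun x => `[< f x = 0 >].
Fact ker_closed : submod_closed ker_pred.
Proof.
split=> [|a x y /asboolP hx /asboolP hy]; apply/asboolP; first exact: linear0.
by rewrite linearP hx hy scaler0 addr0.
Qed.
HB.instance Definition _ := GRing.isSubmodClosed.Build R A ker_pred ker_closed.
Record kernel := Kernel { ker_val : A; _ : ker_val \in ker_pred }.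
HB.instance Definition _ := [isSub for ker_val].
HB.instance Definition _ := [Choice of kernel by <:].
HB.instance Definition _ := [SubChoice_isSubLmodule of kernel by <:].
End Kernel.

Lemma projective_lift (P A B D : lmodType R) (e : {linear A -> B})
    (f : {linear B -> D}) (t : {linear P -> B}) :
  projective P -> (forall b, f b = 0 <-> exists a, e a = b) ->
  (forall x, f (t x) = 0) -> exists h : {linear P -> A}, forall x, e (h x) = t x.
Proof.
move=> projP ex ft.
have he a : e a \in ker_pred f by apply/asboolP/ex; exists a.
have ht x : t x \in ker_pred f by apply/asboolP.
have [e1 he1] : exists e1 : {linear A -> kernel f}, forall a, e1 a = Kernel (he a).
  by apply: linear_of => c x y; apply: val_inj; rewrite /= linearP.
have [t1 ht1] : exists t1 : {linear P -> kernel f}, forall x, t1 x = Kernel (ht x).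
  by apply: linear_of => c x y; apply: val_inj; rewrite /= linearP.
have [[b hb]|h hh] := projP _ _ e1 t1.
  have /asboolP/ex[a ha] := hb; exists a.
  by rewrite he1; apply: val_inj.
exists h => x; have := congr1 val (hh x).
by rewrite he1 ht1.
Qed.

Lemma projective_rV n : projective 'rV[R]_n.
Proof.
move=> A B e t surj.
pose c i := projT1 (cid (surj (t (delta_mx 0 i)))).
have hc i : e (c i) = t (delta_mx 0 i) by rewrite /c; case: cid.
have [h hh] : exists h : {linear 'rV[R]_n -> A}, forall x, h x = \sum_i x 0 i *: c i.
  apply: linear_of => a x y; rewrite scaler_sumr -big_split.
  by apply: eq_bigr => i _; rewrite !mxE scalerDl scalerA.
exists h => x; rewrite hh [in RHS](row_sum_delta x) !linear_sum.
by apply: eq_bigr => i _; rewrite !linearZ /= hc.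
Qed.

(** The last equation is the relation 1 = v u + d h + h d in degree n, composed
    with the differential on the right. This form closes the induction without
    mention of h in degree n - 1. *)
Lemma resolution_compare (M : lmodType R) (P Q : projres M) n :
  exists (u0 : {linear pr_obj P n -> pr_obj Q n})
    (u1 : {linear pr_obj P n.+1 -> pr_obj Q n.+1})
    (v0 : {linear pr_obj Q n -> pr_obj P n})
    (v1 : {linear pr_obj Q n.+1 -> pr_obj P n.+1})
    (h : {linear pr_obj P n -> pr_obj P n.+1}),
  [/\ forall x, pr_d Q n (u1 x) = u0 (pr_d P n x),
      forall x, pr_d P n (v1 x) = v0 (pr_d Q n x) &
      forall x, pr_d P n x = v0 (u0 (pr_d P n x)) + pr_d P n (h (pr_d P n x))].
Proof.
have augd (S : projres M) x : pr_aug S (pr_d S 0%N x) = 0.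
  by apply/pr_exact0; exists x.
have dd (S : projres M) k x : pr_d S k (pr_d S k.+1 x) = 0.
  by apply/pr_exactS; exists x.
elim: n => [|n [u0 [u1 [v0 [v1 [h [hu hv hh]]]]]]].
  have [u0 hu0] := @pr_proj _ _ P 0%N _ _ (pr_aug Q) (pr_aug P) (pr_aug_surj Q).
  have [v0 hv0] := @pr_proj _ _ Q 0%N _ _ (pr_aug P) (pr_aug Q) (pr_aug_surj P).
  have [|u1 hu1] := projective_lift (t := u0 \o pr_d P 0 : {linear _ -> _})
    (@pr_proj _ _ P 1%N) (@pr_exact0 _ _ Q).
    by move=> x; rewrite /= hu0 augd.
  have [|v1 hv1] := projective_lift (t := v0 \o pr_d Q 0 : {linear _ -> _})
    (@pr_proj _ _ Q 1%N) (@pr_exact0 _ _ P).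
    by move=> x; rewrite /= hv0 augd.
  have [|h hh] := projective_lift (t := idfun \- (v0 \o u0) : {linear _ -> _})
    (@pr_proj _ _ P 0%N) (@pr_exact0 _ _ P).
    by move=> x; rewrite linearB /= hv0 hu0 subrr.
  exists u0, u1, v0, v1, h; split=> // x.
  by rewrite hh /= addrC subrK.
have [|u2 hu2] := projective_lift (t := u1 \o pr_d P n.+1 : {linear _ -> _})
  (@pr_proj _ _ P n.+2%N) (@pr_exactS _ _ Q n).
  by move=> x; rewrite /= hu dd linear0.
have [|v2 hv2] := projective_lift (t := v1 \o pr_d Q n.+1 : {linear _ -> _})
  (@pr_proj _ _ Q n.+2%N) (@pr_exactS _ _ P n).
  by move=> x; rewrite /= hv dd linear0.
have [|h' hh'] := projective_lift
  (t := idfun \- (v1 \o u1) \- (h \o pr_d P n) : {linear _ -> _})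
  (@pr_proj _ _ P n.+1%N) (@pr_exactS _ _ P n).
  by move=> x; rewrite /= !linearB /= hv hu {1}hh addrAC addrK subrr.
exists u1, u2, v1, v2, h'; split=> // x.
by rewrite hh' /= dd linear0 subr0 addrC subrK.
Qed.

End Comparison.

(** * Annihilation of Ext *)

(** The relation g A = A U A says that g x - x A U is a syzygy for every x, so a
    cocycle psi satisfies g psi(x) = psi(x A U): thus g psi is the coboundary
    of y |-> psi(y U). The comparison of resolutions carries this
    over to an arbitrary resolution P. *)
Lemma regular_annExt (R : comNzRingType) (M N : lmodType R) q
    (A : forall p, 'M[R]_(q p.+1, q p)) (ep : {linear 'rV[R]_(q 0%N) -> M})
    (g : R) n (U : 'M[R]_(q n, q n.+1)) :
  (forall y, exists x, ep x = y) ->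
  (forall x, ep x = 0 <-> exists z, x = z *m A 0%N) ->
  (forall p b (X : 'M_(b, q p.+1)), X *m A p = 0 <-> exists Y, X = Y *m A p.+1) ->
  g *: A n = A n *m U *m A n -> annExt n.+1 M N g.
Proof.
move=> surj ker ex hU P phi cphi.
pose d p : {linear 'rV[R]_(q p.+1) -> 'rV[R]_(q p)} := mulmxr (A p).
have ex0 x : ep x = 0 <-> exists z, d 0%N z = x.
  by split=> [/ker[z ->]|[z <-]]; [exists z|apply/ker; exists z].
have exS p x : d p x = 0 <-> exists z, d p.+1 z = x.
  by split=> [/ex[z ->]|[z <-]]; [exists z|apply/ex; exists z].
pose Q := ProjRes (fun p => @projective_rV R (q p)) surj ex0 exS.
have [u0 [u1 [v0 [v1 [h [hu hv hh]]]]]] := resolution_compare P Q n.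
have cv x : phi (v1 (d n.+1 x)) = 0.
  have /pr_exactS[y <-] : pr_d P n (v1 (d n.+1 x)) = 0.
    rewrite hv; apply: (etrans _ (linear0 v0)); congr (v0 _).
    by apply/exS; exists x.
  exact: cphi.
have hpsi x : g *: phi (v1 x) = phi (v1 (x *m A n *m U)).
  have /ex[y hy] : (g *: x - x *m A n *m U) *m A n = 0.
    by rewrite mulmxBl -scalemxAl scalemxAr hU !mulmxA subrr.
  apply/eqP; rewrite -subr_eq0 -!linearZ -!linearB /= hy; apply/eqP.
  exact: cv.
exists ((phi \o v1 \o mulmxr U \o u0) \+ g \*: (phi \o h) : {linear _ -> _}) => x /=.
have /pr_exactS[y hy] : pr_d P n (x - v1 (u1 x) - h (pr_d P n x)) = 0.
  by rewrite !linearB /= hv hu {1}hh addrAC addrK subrr.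
have e : phi x = phi (v1 (u1 x)) + phi (h (pr_d P n x)).
  have /eqP := cphi y; rewrite hy !linearB /= -addrA -opprD subr_eq0.
  by move=> /eqP.
by rewrite e scalerDr hpsi -[u1 x *m A n]/(d n (u1 x)) hu.
Qed.

Lemma Db_annExt (R : idomainType) d : noetherian R -> generated_in R d ->
  exists2 g : R, g != 0 & forall M N : lmodType R, fgmod M ->
    forall k, (d < k)%N -> annExt k M N g.
Proof.
move=> hN [G hG].
have [f f0 hf] := bcomplex_near_split G.
pose a := f * (f * f); exists (a ^+ d.+1); first by rewrite expf_neq0 ?mulf_neq0.
move=> M N fgM [//|k]; rewrite ltnS => dk.
have [q [A [ep [surj ker ex]]]] := free_resolution hN fgM.
have hC C n i : (d <= n + i)%N -> tor_killed C (a ^+ d.+1) (A i) n.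
  elim: i n => [|i IHi] n; rewrite ?addn0 => dn.
    apply: (kills_tor (d := d.+1) (fgM := fgM) _ _ surj ker) => //.
    rewrite -[X in kills _ _ _ _ X]add0n; apply: kills_thick (hG _) => l j.
    exact/kills_near_split/near_split_shift.
  by apply: (tor_killed_shift (ex i)); apply: IHi; rewrite addSnnS.
have [|U hU] := @tor_killed_regular R (a ^+ d.+1) _ _ (A k) hN.
  by move=> C; apply: hC.
exact: (regular_annExt surj ker ex hU).
Qed.

Theorem theorem4p11 (R : idomainType) (hN : noetherian R)
    (hreg : Db_regular R) (d : nat) (hd : is_Db_rouquier_dim R d) :
  (exists f : R, f != 0 /\
     forall (M N : lmodType R), fgmod M -> fgmod N ->
       forall k : nat, (d < k)%N -> annExt k M N f) /\
  ca R d.+1 <> [set 0].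
Proof.
have [g g0 hg] := Db_annExt hN hd.1.
split; first by exists g; split=> // M N fgM _ k; apply: hg.
have hca : ca R d.+1 g by move=> M N fgM _; apply: hg.
by move=> e; move: hca g0; rewrite e => ->; rewrite eqxx.
Qed.
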